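(* Let $V$ be a Euclidean Jordan algebra with unit $e$ and cone of squares $K$, so that $K^\circ$ is a symmetric cone. Let $x\in K^\circ\setminus\{e\}$ have spectral decomposition $x=\sum_{i=1}^k\lambda_i c_i$, with distinct eigenvalues $\lambda_1,\dots,\lambda_k$ and complete system of orthogonal idempotents $c_1,\dots,c_k$, let \[ \mathcal{C}_x:=\left\{c_i\in\{c_1,\ldots,c_k\}:\ \max\{\lambda_i,\lambda_i^{-1}\}=\max\{\lambda_+(x),\lambda_-(x)^{-1}\}\right\}, \] and put $c:=\sum_{c_i\in\mathcal{C}_x}c_i$. Then the affine span of the midpoints set $\mathcal{M}(x,e)$ satisfies \[ \mathrm{aff}\,\mathcal{M}(x,e)=m_{xe}+V(c,0). \]
   Context: A Euclidean Jordan algebra is a finite-dimensional real inner-product space $(V,\langle\cdot,\cdot\rangle)$ with a bilinear product $\bullet$ such that for all $x,y,z\in V$: $x\bullet y=y\bullet x$; $x\bullet(x^2\bullet y)=x^2\bullet(x\bullet y)$; and $\langle L(x)y,z\rangle=\langle y,L(x)z\rangle$, where $L(x)y:=x\bullet y$. Its unit is $e$. Symmetric cones are exactly the interiors $K^\circ$ of the cones of squares $K=\{x^2:x\in V\}$ of Euclidean Jordan algebras. An idempotent is $c\in V$ with $c^2=c$. A complete system of orthogonal idempotents is a set $\{c_1,\dots,c_k\}$ of idempotents with $c_i\bullet c_j=0$ for $i\ne j$ and $c_1+\dots+c_k=e$. By the spectral theorem each $x\in V$ can be written as $x=\lambda_1c_1+\dots+\lambda_kc_k$ with unique distinct real numbers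 $\lambda_i$ (the eigenvalues) and a complete system of (nonzero) orthogonal idempotents $c_i$; $\sigma(x)=\{\lambda_1,\dots,\lambda_k\}$, $\lambda_+(x)=\max\sigma(x)$, $\lambda_-(x)=\min\sigma(x)$. For an idempotent $c$, $V(c,\lambda)$ denotes the eigenspace $\{z\in V: c\bullet z=\lambda z\}$ of $L(c)$ for $\lambda\in\{0,\tfrac12,1\}$, giving the Peirce decomposition $V=V(c,0)\oplus V(c,\tfrac12)\oplus V(c,1)$. Write $a\le_K b$ if $b-a\in K$. For $x,y\in K^\circ$ let $M(x/y):=\inf\{\beta>0:x\le_K\beta y\}$; Thompson's metric on $K^\circ$ is $d_T(x,y):=\log\max\{M(x/y),M(y/x)\}$, and $\mathcal{M}(x,y):=\{z\in K^\circ:d_T(x,z)=\tfrac12d_T(x,y)=d_T(z,y)\}$. $\mathrm{aff}$ denotes affine span. Canonical midpoint $m_{xy}$: for linearly independent $x,y\in K^\circ$ let $V(x,y)=\mathrm{span}(x,y)$ and $K(x,y)=V(x,y)\cap K$. There are linearly independent linear functionals $\psi_1,\psi_2$ on $V(x,y)$ with $K(x,y)=\{z\in V(x,y):\psi_1(z)\ge0,\ \psi_2(z)\ge0\}$, and $m_{xy}$ is the unique element of $V(x,y)$ with $\psi_i(m_{xy})=\sqrt{\psi_i(x)\psi_i(y)}$ for $i=1,2$. If $x,y\in K^\circ$ are linearly dependent, $y=\lambda x$ with $\lambda>0$, then $m_{xy}:=\sqrt{\lambda}\,x$ (the unique midpoint). *)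

(* Defs.v *)
From HB Require Import structures.
From mathcomp Require Import all_boot all_order all_algebra.
From mathcomp Require Import sesquilinear.
From mathcomp Require Import all_classical all_reals all_analysis.
Set Implicit Arguments.
Unset Strict Implicit.
Unset Printing Implicit Defensive.
Import Order.TTheory GRing.Theory Num.Theory.
Local Open Scope classical_set_scope.
Local Open Scope ring_scope.

Record euclidean_jordan_algebra (R : realType) (V : vectType R) := EJA {
  jmul : {bilinear V -> V -> V};
  inner : {dot V for (@idfun R)};
  junit : V;
  jmulC : forall x y, jmul x y = jmul y x;
  jordan_identity : forall x y,
    jmul x (jmul (jmul x x) y) = jmul (jmul x x) (jmul x y);
  inner_jmul : forall x y z, inner (jmul x y) z = inner y (jmul x z);
  junit_mul : forall x, jmul junit x = x
}.

Definition squares (R : realType) (V : vectType R)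
    (A : euclidean_jordan_algebra V) : set V :=
  [set jmul A x x | x in [set: V]].

(* A vectType carries no topology: the interior is taken for the metric of the
   inner product. *)
Definition interior_of (R : realType) (V : vectType R)
    (A : euclidean_jordan_algebra V) (S : set V) : set V :=
  [set x | exists2 r : R, 0 < r &
    forall y, Num.sqrt (inner A (y - x) (y - x)) < r -> S y].

Definition symmetric_cone (R : realType) (V : vectType R)
    (A : euclidean_jordan_algebra V) : set V :=
  interior_of A (squares A).

Definition cone_le (R : realType) (V : vectType R)
    (A : euclidean_jordan_algebra V) (a b : V) : Prop :=
  squares A (b - a).

Definition idempotent (R : realType) (V : vectType R)
    (A : euclidean_jordan_algebra V) (c : V) : Prop :=
  jmul A c c = c.

Definition complete_orthogonal_system (R : realType) (V : vectType R)
    (A : euclidean_jordan_algebra V) (k : nat) (c : 'I_k -> V) : Prop :=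
  [/\ forall i, idempotent A (c i),
      forall i j, i != j -> jmul A (c i) (c j) = 0
    & \sum_(i < k) c i = junit A].

Definition spectral_decomposition (R : realType) (V : vectType R)
    (A : euclidean_jordan_algebra V) (x : V) (k : nat)
    (lam : 'I_k -> R) (c : 'I_k -> V) : Prop :=
  [/\ injective lam,
      forall i, c i != 0,
      complete_orthogonal_system A c
    & x = \sum_(i < k) lam i *: c i].

Definition spectrum (R : realType) (V : vectType R)
    (A : euclidean_jordan_algebra V) (x : V) : set R :=
  [set t | exists (k : nat) (lam : 'I_k -> R) (c : 'I_k -> V),
    spectral_decomposition A x lam c /\ exists i, t = lam i].

(* The spectrum is finite and, when V is nonzero, nonempty, so that sup and inf
   are its maximum and minimum. *)
Definition lambda_max (R : realType) (V : vectType R)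
    (A : euclidean_jordan_algebra V) (x : V) : R := sup (spectrum A x).

Definition lambda_min (R : realType) (V : vectType R)
    (A : euclidean_jordan_algebra V) (x : V) : R := inf (spectrum A x).

Definition peirce (R : realType) (V : vectType R)
    (A : euclidean_jordan_algebra V) (c : V) (lam : R) : set V :=
  [set z | jmul A c z = lam *: z].

(* M(x/y) *)
Definition Mratio (R : realType) (V : vectType R)
    (A : euclidean_jordan_algebra V) (x y : V) : R :=
  inf [set beta : R | 0 < beta /\ cone_le A x (beta *: y)].

Definition thompson (R : realType) (V : vectType R)
    (A : euclidean_jordan_algebra V) (x y : V) : R :=
  ln (Num.max (Mratio A x y) (Mratio A y x)).

Definition midpoints (R : realType) (V : vectType R)
    (A : euclidean_jordan_algebra V) (x y : V) : set V :=
  [set z | [/\ symmetric_cone A z,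
    thompson A x z = 2^-1 * thompson A x y
    & thompson A z y = 2^-1 * thompson A x y]].

Definition affine_span (R : realType) (V : vectType R) (S : set V) : set V :=
  [set v | exists (n : nat) (t : 'I_n -> R) (z : 'I_n -> V),
    [/\ forall i, S (z i), \sum_(i < n) t i = 1
      & v = \sum_(i < n) t i *: z i]].

Definition is_canonical_midpoint (R : realType) (V : vectType R)
    (A : euclidean_jordan_algebra V) (x y m : V) : Prop :=
  if free [:: x; y] then
    let U := <<[:: x; y]>>%VS in
    exists psi1 psi2 : 'Hom(subvs_of U, R^o), exists mu : subvs_of U,
      [/\ free [:: psi1; psi2],
          forall z : subvs_of U,
            squares A (vsval z) <-> 0 <= psi1 z /\ 0 <= psi2 z,
          psi1 mu = Num.sqrt (psi1 (vsproj U x) * psi1 (vsproj U y)),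
          psi2 mu = Num.sqrt (psi2 (vsproj U x) * psi2 (vsproj U y))
        & m = vsval mu]
  else exists2 lam : R, 0 < lam & y = lam *: x /\ m = Num.sqrt lam *: x.

(* For x and y in the symmetric cone exactly one m satisfies
   is_canonical_midpoint A x y m, because the two functionals are determined up
   to positive scaling and order; elsewhere the value is arbitrary. *)
Definition canonical_midpoint (R : realType) (V : vectType R)
    (A : euclidean_jordan_algebra V) (x y : V) : V :=
  xget 0 [set m | is_canonical_midpoint A x y m].

(* Main.v *)
Require Import Defs.
From HB Require Import structures.
From mathcomp Require Import all_boot all_order all_algebra.
From mathcomp Require Import sesquilinear complex.
From mathcomp Require Import all_classical all_reals all_analysis.
From mathcomp Require Import ring lra.
Set Implicit Arguments.
Unset Strict Implicit.
Unset Printing Implicit Defensive.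
Import Order.TTheory GRing.Theory Num.Theory.
Local Open Scope classical_set_scope.
Local Open Scope ring_scope.

(** Write L(v) for the multiplication by v, <= for the order of the cone K of
    squares, r for the number max(lambda_+(x), 1/lambda_-(x)), s for its square
    root, and u for the sum of the c i over the indices with lam i = r or
    lam i = 1/r (the indices in C).

    As K is closed, M(x/y) <= t means x <= t y; hence d_T(x, e) = log r = 2 log s,
    and by the triangle inequality z is a midpoint of x and e exactly when
    x <= s z, z <= s x, z <= s e and e <= s z ([midpointsP]).

    These inequalities determine z on the idempotents in C.  For instance, if
    lam i = r, pairing x <= s z and z <= s e with c i leaves equality in both;
    so s e - z is an element of K orthogonal to the idempotent c i, and such an
    element is annihilated by c i ([cone_idem_orth]).  Thus
    c i z = sqrt(lam i) c i for all i in C ([midpoint_mulJ]).  The canonical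
    midpoint satisfies the same equations, because its defining functionals on
    the plane span(x, e) are, up to positive factors and order, the extremal
    eigenvalues ([canonical_midpoint_mulJ]).  Hence every midpoint differs from
    m_xe by an element of V(u, 0), and so does every affine combination of
    midpoints.

    Conversely the square root z0 of x satisfies the four inequalities, with
    strict inequality on all spectral idempotents outside C.  The sum of the
    latter is e - u, an order unit of V(u, 0) ([peirce0_bound]); so z0 + t w is a
    midpoint for every w in V(u, 0) and all small t >= 0
    ([midpoints_near_root]).  The lines from z0 through these points cover
    z0 + V(u, 0), which is m_xe + V(u, 0).

    Everything about K rests on two facts.  One is the spectral theorem, obtained
    from power associativity ([evalJM]) and the fact that the minimal polynomial
    of an element has simple real roots, L(x) being symmetric.  The other is the
    self-duality of K ([cone_dualP]), which reduces to L(c) being positive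
    semidefinite for idempotents c, and this to the identity writing its
    quadratic form as a sum of squares ([inner_idem_sqr]). *)

(** * The product and the inner product *)
Section Algebra.
Variables (R : realType) (V : vectType R) (A : euclidean_jordan_algebra V).
Implicit Types (x y z w u v c : V) (a b t : R) (p q : {poly R}).

Local Notation "x ** y" := (jmul A x y) (at level 40, left associativity).
Local Notation e := (junit A).
Local Notation "''[' x , y ]" := (inner A x y) : ring_scope.

Lemma mulJC x y : x ** y = y ** x. Proof. exact: jmulC. Qed.
Lemma mulJDr x y z : x ** (y + z) = x ** y + x ** z.
Proof. exact: linearDr. Qed.
Lemma mulJDl x y z : (y + z) ** x = y ** x + z ** x.
Proof. exact: linearDl. Qed.
Lemma mulJBr x y z : x ** (y - z) = x ** y - x ** z.
Proof. exact: linearBr. Qed.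
Lemma mulJBl x y z : (y - z) ** x = y ** x - z ** x.
Proof. exact: linearBl. Qed.
Lemma mulJNr x y : x ** (- y) = - (x ** y).
Proof. exact: linearNr. Qed.
Lemma mulJZr a x y : x ** (a *: y) = a *: (x ** y).
Proof. exact: linearZr_LR. Qed.
Lemma mulJZl a x y : (a *: y) ** x = a *: (y ** x).
Proof. exact: linearZl_LR. Qed.
Lemma mulJ0r x : x ** 0 = 0. Proof. exact: linear0r. Qed.
Lemma mulJ0l x : 0 ** x = 0. Proof. exact: linear0l. Qed.
Lemma mulJsumr I (r : seq I) (P : pred I) (F : I -> V) x :
  x ** (\sum_(i <- r | P i) F i) = \sum_(i <- r | P i) x ** F i.
Proof. exact: linear_sumr. Qed.
Lemma mulJsuml I (r : seq I) (P : pred I) (F : I -> V) x :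
  (\sum_(i <- r | P i) F i) ** x = \sum_(i <- r | P i) F i ** x.
Proof. exact: linear_sumlz. Qed.
Lemma mul1J x : e ** x = x. Proof. exact: junit_mul. Qed.
Lemma mulJ1 x : x ** e = x. Proof. by rewrite mulJC mul1J. Qed.

Lemma innerC x y : '[x, y] = '[y, x].
Proof. by rewrite (hermitian_subproof (s := inner A)) /= expr0 mul1r. Qed.
Lemma innerDr x y z : '[x, y + z] = '[x, y] + '[x, z].
Proof. exact: linearDr. Qed.
Lemma innerDl x y z : '[y + z, x] = '[y, x] + '[z, x].
Proof. by rewrite !(innerC _ x) innerDr. Qed.
Lemma innerNr x y : '[x, - y] = - '[x, y].
Proof. exact: linearNr. Qed.
Lemma innerNl x y : '[- y, x] = - '[y, x].
Proof. by rewrite !(innerC _ x) innerNr. Qed.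
Lemma innerBl x y z : '[y - z, x] = '[y, x] - '[z, x].
Proof. by rewrite innerDl innerNl. Qed.
Lemma innerZr a x y : '[x, a *: y] = a * '[x, y].
Proof. exact: linearZr_LR. Qed.
Lemma innerZl a x y : '[a *: y, x] = a * '[y, x].
Proof. by rewrite !(innerC _ x) innerZr. Qed.
Lemma inner0r x : '[x, 0] = 0. Proof. exact: linear0r. Qed.
Lemma inner0l x : '[0, x] = 0. Proof. by rewrite innerC inner0r. Qed.
Lemma inner_sumr I (r : seq I) (P : pred I) (F : I -> V) x :
  '[x, \sum_(i <- r | P i) F i] = \sum_(i <- r | P i) '[x, F i].
Proof. exact: linear_sumr. Qed.
Lemma inner_suml I (r : seq I) (P : pred I) (F : I -> V) x :
  '[\sum_(i <- r | P i) F i, x] = \sum_(i <- r | P i) '[F i, x].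
Proof. by rewrite innerC inner_sumr; apply: eq_bigr => i _; rewrite innerC. Qed.
Lemma innerM x y z : '[x ** y, z] = '[y, x ** z].
Proof. exact: inner_jmul. Qed.

Lemma inner_gt0 x : x != 0 -> 0 < '[x, x].
Proof. exact: neq0_dnorm_gt0. Qed.
Lemma inner_ge0 x : 0 <= '[x, x].
Proof.
by have [->|/inner_gt0/ltW//] := eqVneq x 0; rewrite inner0l.
Qed.
Lemma inner_le0_eq0 x : '[x, x] <= 0 -> x = 0.
Proof.
by move=> h; apply/eqP/negPn/negP => /inner_gt0; rewrite ltNge h.
Qed.


(** * Linearizing the Jordan identity *)

(** Testing against all vectors turns an identity between vectors into one
    between real numbers, which ring and lra can decide. *)
Lemma innerP x y : (forall w, '[x, w] = '[y, w]) -> x = y.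
Proof.
move=> h; apply/subr0_eq/inner_le0_eq0.
by rewrite {1}/GRing.add /= innerBl h subrr.
Qed.

(** The terms of degree one in y of the Jordan identity at x + t y: the
    difference of both sides is a cubic in t that vanishes at 0, and three
    further values of t isolate its linear coefficient. *)
Lemma jordan_linearized x y z :
  y ** ((x ** x) ** z) + x ** ((x ** y) ** z) *+ 2 =
  (x ** x) ** (y ** z) + (x ** y) ** (x ** z) *+ 2.
Proof.
apply: innerP => w.
have H t := congr1 (fun v => '[v, w]) (jordan_identity A (x + t *: y) z).
have := H 1; have := H (-1); have := H 2.
rewrite /= !mulr2n !(mulJDl, mulJDr, mulJZl, mulJZr, innerDl, innerZl).
rewrite (mulJC y x) !jordan_identity.
lra.
Qed.

(** The previous identity is quadratic in x; this is its polarization. *)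
Lemma jordan_trilinear x y z w :
  (x ** y) ** (z ** w) + (y ** z) ** (x ** w) + (z ** x) ** (y ** w) =
  z ** ((x ** y) ** w) + x ** ((y ** z) ** w) + y ** ((z ** x) ** w).
Proof.
apply: innerP => u.
have H x := congr1 (fun v => '[v, u]) (jordan_linearized x z w).
have := H (x + y); have := H x; have := H y.
rewrite /= !mulr2n !(mulJDl, mulJDr, innerDl).
rewrite (mulJC y x) (mulJC z x); lra.
Qed.

(** The trilinear identity read as an equation between operators acting on x:
    with L(v) the multiplication by v, it expresses L((yz)w) through L(y),
    L(z), L(w) and the L of products of two of them.  This is what makes
    induction on powers possible. *)
Lemma mulJ_assoc3 x y z w :
  ((y ** z) ** w) ** x = (z ** w) ** (y ** x) + (y ** z) ** (w ** x)
    + (y ** w) ** (z ** x) - z ** (w ** (y ** x)) - y ** (w ** (z ** x)).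
Proof.
apply: innerP => u.
have := congr1 (fun v => '[v, u]) (jordan_trilinear x y z w).
rewrite /= !(innerDl, innerNl).
rewrite (mulJC (x ** y) (z ** w)) (mulJC x y) (mulJC x w) (mulJC (y ** x) w).
rewrite (mulJC x ((y ** z) ** w)) (mulJC z x) (mulJC (x ** z) (y ** w)).
rewrite (mulJC (x ** z) w) (mulJC x z); lra.
Qed.

(** * Idempotents have nonnegative multiplication operators *)

(** Peirce's equation 2 L(c)^3 - 3 L(c)^2 + L(c) = 0: an idempotent has no
    eigenvalues besides 0, 1/2 and 1. *)
Lemma idempotent_cubic c x : c ** c = c ->
  c ** (c ** (c ** x)) *+ 2 = (c ** (c ** x)) *+ 3 - c ** x.
Proof.
move=> cc; apply: innerP => u.
have := congr1 (fun v => '[v, u]) (jordan_linearized c x c).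
rewrite /= !cc !mulr2n !mulrSr mulr0n !(innerDl, innerNl, inner0l).
rewrite (mulJC (c ** x) c) (mulJC x c); lra.
Qed.

(** On the eigenvalues 0, 1/2, 1 the function t agrees with
    8 (t - t^2)^2 + (2 t^2 - t)^2.  Since L(c) is symmetric, its quadratic form
    is therefore a sum of squares, and positivity of L(c) needs no
    diagonalization. *)
Lemma inner_idem_sqr c x : c ** c = c ->
  let d := c ** x - c ** (c ** x) in let g := c ** (c ** x) *+ 2 - c ** x in
  '[c ** x, x] = 8 * '[d, d] + '[g, g].
Proof.
move=> cc d g; rewrite {}/d {}/g.
have H u := congr1 (fun v => '[v, u]) (idempotent_cubic x cc).
have := H (c ** x); have := H x.
rewrite /= !mulr2n !mulrSr mulr0n.
rewrite !(innerDl, innerNl, inner0l, innerDr, innerNr).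
rewrite (innerM c (c ** x) x) (innerM c (c ** (c ** x)) x).
rewrite (innerM c (c ** (c ** x)) (c ** x)) (innerC (c ** x) (c ** (c ** x))).
lra.
Qed.

Lemma inner_idem_ge0 c x : c ** c = c -> 0 <= '[c ** x, x].
Proof.
move=> cc; rewrite (inner_idem_sqr x cc).
by rewrite addr_ge0 ?mulr_ge0 ?inner_ge0.
Qed.

Lemma inner_idem_eq0 c x : c ** c = c -> '[c ** x, x] = 0 -> c ** x = 0.
Proof.
move=> cc /eqP; rewrite (inner_idem_sqr x cc).
rewrite paddr_eq0 ?mulr_ge0 ?inner_ge0 // mulf_eq0 pnatr_eq0 /=.
case/andP=> /eqP h1 /eqP h2.
have {}h1 : c ** x = c ** (c ** x).
  by apply/subr0_eq/inner_le0_eq0; rewrite h1.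
have : c ** (c ** x) *+ 2 - c ** x = 0 by apply: inner_le0_eq0; rewrite h2.
by rewrite -h1 mulr2n addrK.
Qed.

(** * Power associativity *)

Fixpoint powJ x n := if n is m.+1 then x ** powJ x m else e.

(** The heart of power associativity: L(x^n) commutes with L(x) and L(x^2).
    Two consecutive powers are carried through the induction because
    [mulJ_assoc3] expresses L(x^(n+2)) by L(x^(n+1)), L(x^n), L(x), L(x^2). *)
Lemma powJ_comm x n z :
  powJ x n ** (x ** z) = x ** (powJ x n ** z) /\
  powJ x n ** ((x ** x) ** z) = (x ** x) ** (powJ x n ** z).
Proof.
move: z.
suff: (forall z, powJ x n ** (x ** z) = x ** (powJ x n ** z) /\
                 powJ x n ** ((x ** x) ** z) = (x ** x) ** (powJ x n ** z)) /\
  (forall z, powJ x n.+1 ** (x ** z) = x ** (powJ x n.+1 ** z) /\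
             powJ x n.+1 ** ((x ** x) ** z) = (x ** x) ** (powJ x n.+1 ** z)).
  by case.
elim: n => [|n [IHn IHn1]]; split => // z.
- by rewrite /= !mul1J.
- by rewrite /= !mulJ1 jordan_identity.
have L u : powJ x n.+2 ** u = (x ** x) ** (powJ x n ** u)
    + powJ x n.+1 ** (x ** u) + powJ x n.+1 ** (x ** u)
    - x ** (x ** (powJ x n ** u)) - powJ x n ** (x ** (x ** u)).
  have -> : powJ x n.+2 = (powJ x n ** x) ** x.
    by rewrite /= (mulJC x) (mulJC x (powJ x n)).
  by rewrite mulJ_assoc3 (mulJC (powJ x n) x).
have c1 u := (IHn u).1; have c2 u := (IHn u).2.
have c3 u := (IHn1 u).1; have c4 u := (IHn1 u).2.
by split; rewrite !L !(mulJDr, mulJNr) !(c1, c2, c3, c4, jordan_identity).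
Qed.

Definition evalJ x (p : {poly R}) := \sum_(i < size p) p`_i *: powJ x i.

Lemma evalJ_widen x p n : (size p <= n)%N ->
  evalJ x p = \sum_(i < n) p`_i *: powJ x i.
Proof.
move=> le; rewrite /evalJ (big_ord_widen _ (fun i => p`_i *: powJ x i) le).
rewrite big_mkcond; apply: eq_bigr => i _.
by case: ltnP => // h; rewrite nth_default ?scale0r.
Qed.

Lemma evalJD x p q : evalJ x (p + q) = evalJ x p + evalJ x q.
Proof.
pose n := maxn (size p) (size q).
rewrite !(@evalJ_widen _ _ n) ?leq_maxl ?leq_maxr ?size_polyD //.
by rewrite -big_split; apply: eq_bigr => i _; rewrite coefD scalerDl.
Qed.

Lemma evalJZ x a p : evalJ x (a *: p) = a *: evalJ x p.
Proof.
rewrite !(@evalJ_widen _ _ (size p)) ?size_scale_leq // scaler_sumr.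
by apply: eq_bigr => i _; rewrite coefZ scalerA.
Qed.

HB.instance Definition _ x := GRing.isLinear.Build R {poly R} V _ (evalJ x)
  (fun a p q => etrans (evalJD x (a *: p) q) (congr1 (+%R^~ _) (evalJZ x a p))).

Lemma evalJC x a : evalJ x a%:P = a *: e.
Proof.
rewrite (@evalJ_widen _ _ 1) ?size_polyC_leq1 //.
by rewrite big_ord_recl big_ord0 addr0 coefC eqxx.
Qed.

Lemma evalJ1 x : evalJ x 1 = e.
Proof. by rewrite evalJC scale1r. Qed.

Lemma evalJMX x p : evalJ x (p * 'X) = x ** evalJ x p.
Proof.
rewrite (@evalJ_widen _ (p * 'X) (size p).+1); last first.
  by rewrite (leq_trans (size_polyMleq _ _)) // size_polyX addn2.
rewrite big_ord_recl coefMX eqxx scale0r add0r mulJsumr.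
by apply: eq_bigr => i _; rewrite coefMX /= mulJZr.
Qed.

Lemma evalJX x : evalJ x 'X = x.
Proof. by rewrite -['X]mul1r evalJMX evalJ1 mulJ1. Qed.

(** Power associativity: evaluation at x is an algebra morphism. *)
Lemma evalJM x p q : evalJ x (p * q) = evalJ x p ** evalJ x q.
Proof.
have comm z : x ** (evalJ x q ** z) = evalJ x q ** (x ** z).
  rewrite /evalJ mulJsuml mulJsumr mulJsuml; apply: eq_bigr => i _.
  by rewrite !mulJZl !mulJZr (powJ_comm x i z).1.
elim/poly_ind: p => [|p a IHp]; first by rewrite mul0r linear0 mulJ0l.
rewrite mulrDl !linearD /= mul_polyC evalJZ mulrAC (evalJMX x (p * q)) IHp.
rewrite mulJDl evalJC mulJZl mul1J evalJMX; congr (_ + _).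
by rewrite (mulJC (evalJ x p)) comm mulJC.
Qed.

End Algebra.
(** * The spectral theorem *)

(** The only use of complex numbers: a complex root a + ib of a real polynomial
    gives a real linear or quadratic factor. *)
Lemma real_poly_factor (F : rcfType) (p : {poly F}) : size p != 1 ->
  (exists a, root p a) \/
  exists a b, b != 0 /\ (('X - a%:P) ^+ 2 + (b ^+ 2)%:P %| p)%R.
Proof.
move=> szp; pose toC := complex.real_complex F.
have /closed_rootP[[a b] rz] : size (map_poly toC p) != 1.
  by rewrite size_map_poly.
have [b0|b0] := eqVneq b 0.
  left; exists a; rewrite -(fmorph_root toC).
  by move: rz; rewrite b0.
right; exists a, b; split => //.
set q := _ + _; set z := complex.Complex a b in rz.
have qz : (map_poly toC q).[z] = 0.
  rewrite /q rmorphD rmorphXn rmorphB /= map_polyX !map_polyC /=.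
  rewrite !hornerE.
  apply/eqP; rewrite complex.eq_complex /= /z /toC /=.
  by apply/andP; split; apply/eqP; ring.
have szq : size q = 3%N.
  rewrite /q size_polyDl size_exp_XsubC //.
  by rewrite (leq_ltn_trans (size_polyC_leq1 _)).
have rz2 : (map_poly toC (p %% q)).[z] = 0.
  move/rootP: rz; rewrite {1}(divp_eq p q) rmorphD rmorphM /= hornerD hornerM.
  by rewrite qz mulr0 add0r.
have szr : (size (map_poly toC (p %% q)) <= 2)%N.
  by rewrite size_map_poly -ltnS -szq ltn_modp -size_poly_eq0 szq.
move: rz2; rewrite (horner_coef_wide _ szr) !big_ord_recl big_ord0 /=.
rewrite !coef_map /= expr0 mulr1 addr0 expr1 => /eqP.
rewrite complex.eq_complex /= !(mul0r, add0r, addr0, subr0, mulr0).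
case/andP=> /eqP h0 /eqP/(canRL (mulfK b0)); rewrite mul0r => r1.
rewrite r1 mul0r addr0 in h0.
apply/modp_eq0P/polyP => i; rewrite coef0.
case: i => [|[|i]] //.
by rewrite nth_default // -(size_map_poly toC) (leq_trans szr).
Qed.

Section Spectral.
Variables (R : realType) (V : vectType R) (A : euclidean_jordan_algebra V).
Implicit Types (x y z w u v c : V) (a b t : R) (p q : {poly R}).

Local Notation "x ** y" := (jmul A x y) (at level 40, left associativity).
Local Notation e := (junit A).
Local Notation "''[' x , y ]" := (inner A x y) : ring_scope.

(** More powers of x than the dimension cannot be linearly independent. *)
Lemma annihilator_exists x : exists2 p, p != 0 & evalJ A x p = 0.
Proof.
pose n := (\dim {: V}).+1.
pose X := [tuple powJ A x i | i < n].
have nf : ~~ free X.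
  apply/negP => /eqP fX; have := dimvS (subvf <<X>>%VS).
  by rewrite fX size_tuple ltnn.
apply: contrapT => no; case/negP: nf; apply/freeP => k k0 i.
pose p := \poly_(j < n) k (inord j).
have ki : p`_i = k i by rewrite coef_poly ltn_ord inord_val.
have [p0|p0] := eqVneq p 0; first by rewrite -ki p0 coef0.
case: no; exists p => //; rewrite (evalJ_widen A x (size_poly _ _)) -[RHS]k0.
apply: eq_bigr => j _.
by rewrite coef_poly ltn_ord inord_val (nth_map j) ?size_enum_ord // nth_ord_enum.
Qed.

(** The minimal polynomial of x up to a scalar, characterized by its degree. *)
Definition minimal_annihilator x p := [/\ p != 0, evalJ A x p = 0 &
  forall q, evalJ A x q = 0 -> (size q < size p)%N -> q = 0].

Lemma minimal_annihilator_exists x : exists p, minimal_annihilator x p.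
Proof.
pose P n := `[< exists2 p, p != 0 & evalJ A x p = 0 /\ size p = n >].
have exP : exists n, P n.
  have [p p0 ep] := annihilator_exists x.
  by exists (size p); apply/asboolP; exists p.
case: (ex_minnP exP) => n /asboolP[p p0 [ep szp]] minp.
exists p; split => // q eq; rewrite szp => szq; apply/eqP/negPn/negP => q0.
have : P (size q) by apply/asboolP; exists q.
by move/minp; rewrite leqNgt szq.
Qed.

(** Symmetry of L(x), in the form <(L(x) - a)^2 v, v> = |(L(x) - a) v|^2. *)
Lemma evalJ_sqr x a p : 
  '[evalJ A x (('X - a%:P) ^+ 2 * p), evalJ A x p] =
  '[evalJ A x (('X - a%:P) * p), evalJ A x (('X - a%:P) * p)].
Proof. by rewrite expr2 -mulrA [in LHS]evalJM [in RHS]evalJM innerM -evalJM. Qed.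

(** A factor (X - a)^2 + b^2 with b <> 0 cannot divide the minimal polynomial p:
    if v is the value at x of the cofactor h, then
    |(L(x) - a) v|^2 + b^2 |v|^2 = <p(x), v> = 0, so v = 0 although h has smaller
    degree than p. *)
Lemma minimal_dvd_root x p g : minimal_annihilator x p -> g %| p ->
  size g != 1 -> exists a, root g a.
Proof.
case=> p0 ep minp gp szg; case: (real_poly_factor szg) => // -[a [b [b0 qg]]].
exfalso; have /dvdpP[h ph] := dvdp_trans qg gp.
have szq : size (('X - a%:P) ^+ 2 + (b ^+ 2)%:P) = 3%N.
  rewrite size_polyDl size_exp_XsubC //.
  by rewrite (leq_ltn_trans (size_polyC_leq1 _)).
have h0 : h != 0 by apply: contraNneq p0 => h0; rewrite ph h0 mul0r.
have q0 : ('X - a%:P) ^+ 2 + (b ^+ 2)%:P != 0 by rewrite -size_poly_eq0 szq.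
have := congr1 (fun v => '[v, evalJ A x h]) ep.
rewrite /= ph mulrC mulrDl evalJD mul_polyC evalJZ innerDl innerZl evalJ_sqr.
rewrite inner0l => /eqP.
rewrite (paddr_eq0 (inner_ge0 _ _) (mulr_ge0 (sqr_ge0 b) (inner_ge0 _ _))).
case/andP=> _.
rewrite mulf_eq0 sqrf_eq0 (negPf b0) /= => /eqP hh.
have /minp : evalJ A x h = 0 by apply: (@inner_le0_eq0 _ _ A); rewrite hh.
rewrite ph size_mul // szq addn3 /= leqnSn => /(_ isT) hz.
by rewrite hz eqxx in h0.
Qed.

(** By the same computation with b = 0, (X - a) h would already annihilate x. *)
Lemma minimal_dvd_sqrfree x p a :
  minimal_annihilator x p -> ~~ (('X - a%:P) ^+ 2 %| p).
Proof.
case=> p0 ep minp; apply/negP => /dvdpP[h ph].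
have h0 : h != 0 by apply: contraNneq p0 => h0; rewrite ph h0 mul0r.
have := congr1 (fun v => '[v, evalJ A x h]) ep.
rewrite /= ph mulrC evalJ_sqr inner0l => hh.
have /minp : evalJ A x (('X - a%:P) * h) = 0.
  by apply: (@inner_le0_eq0 _ _ A); rewrite hh.
rewrite ph (size_mul _ h0) ?polyXsubC_eq0 // (size_mul h0); last first.
  by rewrite expf_neq0 ?polyXsubC_eq0.
rewrite size_exp_XsubC size_XsubC addn3 add2n /= leqnn => /(_ isT)/eqP.
by rewrite mulf_eq0 polyXsubC_eq0 (negPf h0).
Qed.

(** Stated for all divisors so that linear factors can be removed one by
    one. *)
Lemma minimal_dvd_split x p g : minimal_annihilator x p -> g %| p ->
  exists2 s : seq R, uniq s & g %= \prod_(z <- s) ('X - z%:P).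
Proof.
move=> pm; have [n] := ubnP (size g); elim: n g => // n IHn g szg gp.
have p0 : p != 0 by case: pm.
have g0 : g != 0 by apply: contraNneq p0 => g0; rewrite -dvd0p -g0.
have [sz1|/(minimal_dvd_root pm gp)[a]] := eqVneq (size g) 1.
  by exists [::] => //; rewrite big_nil -size_poly_eq1 sz1.
rewrite -dvdp_XsubCl => /dvdpP[h gh].
have h0 : h != 0 by apply: contraNneq g0 => h0; rewrite gh h0 mul0r.
have [] := IHn h.
- by move: szg; rewrite gh size_Mmonic ?monicXsubC // size_XsubC addn2.
- by apply: dvdp_trans gp; rewrite gh dvdp_mulr.
move=> s us hs; exists (a :: s); last first.
  by rewrite big_cons gh mulrC eqp_mull.
rewrite /= us andbT; apply/negP => a_s.
move/negP: (minimal_dvd_sqrfree a pm); apply.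
apply: dvdp_trans gp; rewrite gh expr2 dvdp_mul //.
by rewrite (eqp_dvdr _ hs) dvdp_XsubCl root_prod_XsubC.
Qed.

Lemma minimal_dvdE x p f : minimal_annihilator x p ->
  (evalJ A x f == 0) = (p %| f).
Proof.
case=> p0 ep minp; rewrite {1}(divp_eq f p) evalJD evalJM ep mulJ0r add0r.
apply/eqP/idP => [/minp|/modp_eq0P->]; last by rewrite linear0.
by rewrite ltn_modp => /(_ p0) /modp_eq0P.
Qed.

Definition lagrange_at (s : seq R) a : {poly R} :=
  \prod_(b <- rem a s) ((a - b)^-1 *: ('X - b%:P)).

Lemma horner_lagrange_at (s : seq R) a b : uniq s -> a \in s -> b \in s ->
  (lagrange_at s a).[b] = (a == b)%:R.
Proof.
move=> us sa sb; rewrite horner_prod; have [<-|ab] := eqVneq a b.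
  apply: big1_seq => z /andP[_]; rewrite mem_rem_uniq // => /andP[/= za _].
  by rewrite !hornerE mulVf // subr_eq0 eq_sym.
have bs : b \in rem a s by rewrite mem_rem_uniq // inE eq_sym ab.
by rewrite (big_rem b bs) /= !hornerE subrr mulr0 mul0r.
Qed.

(** The minimal polynomial has simple real roots, so a polynomial vanishes at x
    as soon as it vanishes at these roots.  The idempotents are the values at x
    of the Lagrange polynomials of the roots: all required identities hold at
    every root, and hence at x. *)
Theorem spectral_theorem x : exists (k : nat) (lam : 'I_k -> R) (c : 'I_k -> V),
  spectral_decomposition A x lam c.
Proof.
have [p pm] := minimal_annihilator_exists x.
have [s us ps] := minimal_dvd_split pm (dvdpp p).
have ev0 f : (forall a, a \in s -> f.[a] = 0) -> evalJ A x f = 0.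
  move=> fs; apply/eqP; rewrite (minimal_dvdE _ pm) (eqp_dvdl _ ps).
  apply: uniq_roots_dvdp; last by rewrite uniq_rootsE.
  by apply/allP => a /fs/eqP.
have ev f g : (forall a, a \in s -> f.[a] = g.[a]) -> evalJ A x f = evalJ A x g.
  move=> fg; apply/subr0_eq; rewrite -linearB; apply: ev0 => a /fg h.
  by rewrite hornerD hornerN h subrr.
pose lam (i : 'I_(size s)) := s`_i.
have ls i : lam i \in s by rewrite mem_nth.
have lami : injective lam.
  by move=> i j /eqP; rewrite nth_uniq // => /eqP/val_inj.
have lagE i j : (lagrange_at s (lam i)).[lam j] = (i == j)%:R.
  by rewrite horner_lagrange_at // (inj_eq lami).
have sI a : a \in s -> exists i, a = lam i.
  move=> sa; have ia : (index a s < size s)%N by rewrite index_mem.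
  by exists (Ordinal ia); rewrite /lam nth_index.
exists (size s), lam, (fun i => evalJ A x (lagrange_at s (lam i))); split=> //.
- move=> i; rewrite (minimal_dvdE _ pm); apply/negP.
  rewrite (eqp_dvdl _ ps) => dv.
  have : root (lagrange_at s (lam i)) (lam i).
    by apply: (root_dvdp dv); rewrite root_prod_XsubC.
  by rewrite rootE lagE eqxx oner_eq0.
- split.
  + move=> i; rewrite /Defs.idempotent /= -evalJM; apply: ev => _ /sI[j ->].
    by rewrite hornerM lagE; case: eqP; rewrite ?mul1r ?mul0r.
  + move=> i j ij; rewrite /= -evalJM; apply: ev0 => _ /sI[l ->].
    rewrite hornerM !lagE; case: (eqVneq i l) => [<-|]; rewrite ?mul0r //.
    by rewrite eq_sym (negPf ij) mulr0.
  + rewrite -raddf_sum -(evalJ1 A x); apply: ev => _ /sI[j ->].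
    rewrite horner_sum hornerC (bigD1 j) //= lagE eqxx big1 ?addr0 // => i ij.
    by rewrite lagE (negPf ij).
- under eq_bigr do rewrite -evalJZ.
  rewrite -raddf_sum -{1}(evalJX A x); apply: ev => _ /sI[j ->].
  rewrite horner_sum hornerX (bigD1 j) //= hornerZ lagE eqxx mulr1.
  by rewrite big1 ?addr0 // => i ij; rewrite hornerZ lagE (negPf ij) mulr0.
Qed.
End Spectral.
(** * The cone of squares *)
Section Cone.
Variables (R : realType) (V : vectType R) (A : euclidean_jordan_algebra V).
Implicit Types (x y z w u v c d : V) (a b t : R).

Local Notation "x ** y" := (jmul A x y) (at level 40, left associativity).
Local Notation e := (junit A).
Local Notation "''[' x , y ]" := (inner A x y) : ring_scope.
Local Notation K := (squares A).
Local Notation "x <=K y" := (cone_le A x y) (at level 70).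

Lemma square_cone x : K (x ** x). Proof. by exists x. Qed.

Lemma idempotent_cone c : c ** c = c -> K c.
Proof. by move=> <-; apply: square_cone. Qed.

Section System.
Variables (k : nat) (c : 'I_k -> V).
Hypothesis sys : complete_orthogonal_system A c.

Lemma sys_idem i : c i ** c i = c i. Proof. by case: sys => h _ _; apply: h. Qed.

Lemma sys_mulJ (a : 'I_k -> R) j : c j ** (\sum_(i < k) a i *: c i) = a j *: c j.
Proof.
rewrite mulJsumr (bigD1 j) //= big1 ?addr0 ?mulJZr ?sys_idem // => i ij.
by case: sys => _ orth _; rewrite mulJZr orth ?scaler0 // eq_sym.
Qed.

Lemma sys_mulJ2 (a b : 'I_k -> R) :
  (\sum_(i < k) a i *: c i) ** (\sum_(i < k) b i *: c i) =
  \sum_(i < k) (a i * b i) *: c i.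
Proof.
rewrite mulJsuml; apply: eq_bigr => i _.
by rewrite mulJZl sys_mulJ scalerA.
Qed.

Lemma sys_inner (a : 'I_k -> R) j :
  '[\sum_(i < k) a i *: c i, c j] = a j * '[c j, c j].
Proof. by rewrite -{1}(sys_idem j) -innerM sys_mulJ innerZl. Qed.

Lemma sys_junit : e = \sum_(i < k) 1 *: c i.
Proof. by case: sys => _ _ <-; apply: eq_bigr => i _; rewrite scale1r. Qed.

Lemma sys_cone (a : 'I_k -> R) :
  (forall i, 0 <= a i) -> K (\sum_(i < k) a i *: c i).
Proof.
move=> a0; exists (\sum_(i < k) Num.sqrt (a i) *: c i) => //.
rewrite sys_mulJ2; apply: eq_bigr => i _.
by rewrite -expr2 sqr_sqrtr.
Qed.
End System.

Lemma inner_idem_sqr_ge0 c y : c ** c = c -> 0 <= '[c, y ** y].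
Proof. by move=> cc; rewrite -innerM mulJC inner_idem_ge0. Qed.

(** Self-duality of the cone of squares.  For idempotents c, <c, y^2> is the
    quadratic form of L(c) at y and thus nonnegative; conversely, pairing x with
    its own spectral idempotents gives the signs of its eigenvalues.  Being a
    convex cone and being closed follow from this description. *)
Lemma cone_dualP x : K x <-> forall y, 0 <= '[x, y ** y].
Proof.
split=> [[w _ <-] y|h].
  have [k [lam [c [_ _ sys ->]]]] := spectral_theorem A w.
  rewrite (sys_mulJ2 sys) inner_suml sumr_ge0 // => i _.
  rewrite innerZl -expr2 mulr_ge0 ?sqr_ge0 //.
  by apply: inner_idem_sqr_ge0; apply: (sys_idem sys).
have [k [lam [c [_ c0 sys xE]]]] := spectral_theorem A x.
rewrite xE; apply: (sys_cone sys) => i.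
have := h (c i); rewrite (sys_idem sys) xE (sys_inner sys).
by rewrite pmulr_lge0 // inner_gt0.
Qed.

Lemma inner_cone_ge0 x y : K x -> K y -> 0 <= '[x, y].
Proof. by move=> /cone_dualP h [z _ <-]; apply: h. Qed.

Lemma coneD x y : K x -> K y -> K (x + y).
Proof.
move=> /cone_dualP hx /cone_dualP hy; apply/cone_dualP => z.
by rewrite innerDl addr_ge0.
Qed.

Lemma coneZ a x : 0 <= a -> K x -> K (a *: x).
Proof.
move=> a0 /cone_dualP hx; apply/cone_dualP => z.
by rewrite innerZl mulr_ge0.
Qed.

(** The form of closedness used below: limits along segments. *)
Lemma cone_closed x y : (forall t, 0 < t -> K (x + t *: y)) -> K x.
Proof.
move=> h; apply/cone_dualP => z.
have {}h t : 0 < t -> 0 <= '[x, z ** z] + t * '[y, z ** z].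
  by move=> /h/cone_dualP/(_ z); rewrite innerDl innerZl.
apply/ler_addgt0Pr => eps eps0.
set f := '[x, _] in h *; set g := '[y, _] in h.
have g1 : 0 < `|g| + 1 by rewrite ltr_wpDl.
have := h (eps / (`|g| + 1)) (divr_gt0 eps0 g1).
move/le_trans; apply; rewrite lerD2l -mulrA ger_pMr // mulrC.
rewrite ler_pdivrMr // mul1r (le_trans (ler_norm g)) // lerDl //.
Qed.

(** Write x = w^2 and w = sum of m_i d_i: <x, c> is the sum of the m_i^2 <d_i, c>
    with all terms nonnegative, so <d_i, c> = <c d_i, d_i> vanishes whenever
    m_i does not, and then c d_i = 0 by [inner_idem_eq0]. *)
Lemma cone_idem_orth c x : c ** c = c -> K x -> '[x, c] = 0 -> c ** x = 0.
Proof.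
move=> cc [w _ <-] h.
have [k [lam [d [_ d0 sys wE]]]] := spectral_theorem A w.
move: h; rewrite wE (sys_mulJ2 sys) inner_suml => /eqP.
have ge0 i : 0 <= '[d i, c].
  by rewrite -cc inner_idem_sqr_ge0 //; exact: (sys_idem sys i).
rewrite psumr_eq0 => [/allP h|i _]; last by rewrite innerZl -expr2 mulr_ge0 ?sqr_ge0.
rewrite mulJsumr big1 // => i _; rewrite mulJZr.
have := h i (mem_index_enum i); rewrite innerZl mulf_eq0.
case/orP=> [/eqP->|/eqP di]; first by rewrite scale0r.
by rewrite inner_idem_eq0 ?scaler0 // mulJC innerM (sys_idem sys) innerC.
Qed.

Lemma cone_le_trans y x z : x <=K y -> y <=K z -> x <=K z.
Proof. by move=> xy yz; have := coneD yz xy; rewrite addrA subrK. Qed.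

Lemma cone_leZ a x y : 0 <= a -> x <=K y -> a *: x <=K a *: y.
Proof. by move=> a0 xy; rewrite /cone_le -scalerBr; apply: coneZ. Qed.

Lemma cone_le0_anti x : 0 <=K x -> x <=K 0 -> x = 0.
Proof.
rewrite /cone_le subr0 sub0r => h1 h2; apply: (@inner_le0_eq0 _ _ A).
by rewrite -oppr_ge0 -innerNl inner_cone_ge0.
Qed.

Lemma junit_cone : K e.
Proof. by rewrite -(mul1J A e); apply: square_cone. Qed.

(* bounds of the spectrum *)
Lemma sys_coneP k (c : 'I_k -> V) (a : 'I_k -> R) :
  complete_orthogonal_system A c -> (forall i, c i != 0) ->
  K (\sum_(i < k) a i *: c i) <-> forall i, 0 <= a i.
Proof.
move=> sys c0; split=> [Ka i|]; last exact: sys_cone.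
have := inner_cone_ge0 Ka (idempotent_cone (sys_idem sys i)).
by rewrite (sys_inner sys) pmulr_lge0 ?inner_gt0.
Qed.

Lemma spectral_comb x k (lam : 'I_k -> R) (c : 'I_k -> V) a b :
  spectral_decomposition A x lam c ->
  a *: x + b *: e = \sum_(i < k) (a * lam i + b) *: c i.
Proof.
move=> [_ _ sys ->]; rewrite (sys_junit sys) !scaler_sumr -big_split.
by apply: eq_bigr => i _; rewrite /= !scalerA mulr1 scalerDl.
Qed.

Lemma spectral_combP x k (lam : 'I_k -> R) (c : 'I_k -> V) a b :
  spectral_decomposition A x lam c ->
  K (a *: x + b *: e) <-> forall i, 0 <= a * lam i + b.
Proof.
by move=> dec; rewrite (spectral_comb _ _ dec); case: dec => _ ? ? _; apply: sys_coneP.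
Qed.
End Cone.
(** * Interior points and midpoints for Thompson's metric *)
Section Thompson.
Variables (R : realType) (V : vectType R) (A : euclidean_jordan_algebra V).
Implicit Types (x y z w u v c d : V) (a b t : R).

Local Notation "x ** y" := (jmul A x y) (at level 40, left associativity).
Local Notation e := (junit A).
Local Notation "''[' x , y ]" := (inner A x y) : ring_scope.
Local Notation K := (squares A).
Local Notation "x <=K y" := (cone_le A x y) (at level 70).

Lemma cone_le_bound x : exists2 b, 0 < b & x <=K b *: e.
Proof.
have [k [lam [c dec]]] := spectral_theorem A x.
have s0 : 0 <= \sum_i `|lam i| by apply: sumr_ge0.
exists (1 + \sum_i `|lam i|); first by rewrite ltr_pwDl.
rewrite /cone_le addrC -scaleN1r; apply/(spectral_combP _ _ dec) => i.
rewrite mulN1r addrC subr_ge0 (le_trans (ler_norm _)) // (bigD1 i) //= addrCA lerDl addr_ge0 //.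
exact: sumr_ge0.
Qed.

(** The order-theoretic description of the interior of the cone, used in place
    of balls. *)
Definition above_unit x := exists2 a, 0 < a & a *: e <=K x.

Lemma symmetric_cone_above z : symmetric_cone A z -> above_unit z.
Proof.
move=> [r r0 rz]; pose n := Num.sqrt '[e, e].
have n1 : 0 < n + 1 by rewrite ltr_wpDl ?sqrtr_ge0.
exists (r / (n + 1)); first by rewrite divr_gt0.
have a0 : 0 <= r / (n + 1) by rewrite divr_ge0 // ltW.
apply: rz; rewrite addrAC subrr add0r innerNl innerNr opprK innerZl innerZr.
rewrite mulrA -expr2 sqrtrM ?sqr_ge0 // sqrtr_sqr ger0_norm //.
by rewrite -mulrA gtr_pMr // mulrC ltr_pdivrMr // mul1r ltrDl.
Qed.

(** A ball around any one point x of the cone, together with a bound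
    x <= b e, gives a ball around e by translation, and by scaling a ball around
    every z above a positive multiple of e. *)
Lemma above_symmetric_cone x z :
  symmetric_cone A x -> above_unit z -> symmetric_cone A z.
Proof.
move=> [r r0 rx] [a a0 az]; have [b b0 xb] := cone_le_bound x.
have ba : 0 < b / a by rewrite divr_gt0.
exists (r / (b / a)); first by rewrite divr_gt0.
move=> y ry; pose w := (b / a) *: (y - z).
have Kw : K (x + w).
  apply: rx; rewrite addrAC subrr add0r innerZl innerZr mulrA -expr2.
  rewrite sqrtrM ?sqr_ge0 // sqrtr_sqr gtr0_norm //.
  by rewrite mulrC -ltr_pdivlMr.
have := coneZ (ltW (divr_gt0 a0 b0)) (coneD xb Kw).
rewrite addrA subrK scalerDr !scalerA divfK ?gt_eqF //.
rewrite mulf_div (mulrC a) divff ?scale1r ?mulf_neq0 ?gt_eqF // => h.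
by have := coneD az h; rewrite addrA subrK addrC subrK.
Qed.

Lemma above_cone z : above_unit z -> K z.
Proof.
move=> [a a0 az].
by have := coneD az (coneZ (ltW a0) (junit_cone A)); rewrite subrK.
Qed.

Lemma above_bound x y : above_unit y -> exists2 b, 0 < b & x <=K b *: y.
Proof.
move=> [a a0 ay]; have [b b0 xb] := cone_le_bound x.
exists (b / a); first by rewrite divr_gt0.
apply: cone_le_trans xb _.
have := cone_leZ (ltW (divr_gt0 b0 a0)) ay.
by rewrite scalerA divfK // gt_eqF.
Qed.

(** Closedness of the cone makes the infimum defining M(x/y) attained. *)
Lemma Mratio_le x y t : above_unit y -> 0 < t ->
  (Mratio A x y <= t) <-> x <=K t *: y.
Proof.
move=> uy t0; rewrite /Mratio; set S := [set _ | _].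
have lbS : lbound S 0 by move=> b [/ltW].
have [b b0 xb] := above_bound x uy.
have hS : has_inf S by split; [exists b | exists 0].
split=> [le|xt]; last by apply: ge_inf; [exists 0 | split].
apply: (@cone_closed _ _ _ _ y) => eps eps0.
have [u [u0 xu] ult] := inf_adherent eps0 hS.
have ut : 0 <= t + eps - u by rewrite subr_ge0 ltW // (lt_le_trans ult) // lerD2r.
have := coneD (coneZ ut (above_cone uy)) xu.
by rewrite addrA -scalerDl subrK scalerDl addrAC.
Qed.

Hypothesis e0 : e != 0.

(** M(x/y) = 0 would give x <= t y for all t > 0 and so x <= 0.  Positivity
    matters because the logarithm is monotone only on positive numbers. *)
Lemma Mratio_gt0 x y : above_unit x -> above_unit y -> 0 < Mratio A x y.
Proof.
move=> ux uy; rewrite ltNge; apply/negP => le0.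
have Kx : K (- x).
  apply: (@cone_closed _ _ _ _ y) => t t0.
  by rewrite addrC; apply/(Mratio_le x uy t0)/(le_trans le0 (ltW t0)).
have x0 : x = 0.
  apply: (@cone_le0_anti _ _ A); rewrite /cone_le ?subr0 ?sub0r //.
  exact: above_cone.
have [a a0] := ux; rewrite x0 /cone_le sub0r -scaleNr => Ke.
have := inner_cone_ge0 Ke (junit_cone A).
by rewrite innerZl nmulr_rge0 ?oppr_lt0 // leNgt inner_gt0.
Qed.

Lemma thompson_le x y t : above_unit x -> above_unit y -> 0 < t ->
  (thompson A x y <= ln t) <-> (x <=K t *: y /\ y <=K t *: x).
Proof.
move=> ux uy t0; rewrite /thompson ler_ln ?posrE ?lt_max ?Mratio_gt0 //.
rewrite ge_max; split=> [/andP[h1 h2]|[h1 h2]].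
  by split; [apply/(Mratio_le _ uy t0) | apply/(Mratio_le _ ux t0)].
by apply/andP; split; [apply/(Mratio_le _ uy t0) | apply/(Mratio_le _ ux t0)].
Qed.

(** The inequalities on the right say that both distances are at most half of
    the distance from x to y; the triangle inequality then forces equality. *)
Lemma midpointsP x y s : symmetric_cone A x -> above_unit y -> 0 < s ->
  thompson A x y = ln (s ^+ 2) -> forall z,
  midpoints A x y z <-> above_unit z /\
   [/\ x <=K s *: z, z <=K s *: x, z <=K s *: y & y <=K s *: z].
Proof.
move=> sx uy s0 dxy z; have ux := symmetric_cone_above sx.
have half : 2^-1 * thompson A x y = ln s.
  by rewrite dxy lnXn // -[ln s *+ 2]mulr_natl mulKf.
rewrite /midpoints /= half; split=> [[sz d1 d2]|[uz [h1 h2 h3 h4]]].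
  have uz := symmetric_cone_above sz; split=> //.
  by case: (thompson_le ux uz s0) => + _; rewrite d1 => /(_ (lexx _))[? ?];
     case: (thompson_le uz uy s0) => + _; rewrite d2 => /(_ (lexx _))[? ?].
have tri u v w t : above_unit u -> above_unit v -> above_unit w -> 0 < t ->
  u <=K t *: v -> v <=K t *: u -> v <=K s *: w -> w <=K s *: v ->
  thompson A u w <= ln (t * s).
  move=> uu uv uw t0 h h' g g'.
  apply/(thompson_le uu uw (mulr_gt0 t0 s0)); split.
    by apply: cone_le_trans h _; rewrite -scalerA; apply: cone_leZ (ltW t0) g.
  by apply: cone_le_trans g' _; rewrite mulrC -scalerA; apply: cone_leZ (ltW s0) h'.
have dC u v : thompson A u v = thompson A v u by rewrite /thompson maxC.
have tE u v : above_unit u -> above_unit v -> exists2 t, 0 < t &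
    [/\ thompson A u v = ln t, u <=K t *: v & v <=K t *: u].
  move=> uu uv; exists (expR (thompson A u v)); first exact: expR_gt0.
  have [] := (thompson_le uu uv (expR_gt0 (thompson A u v))).
  by rewrite expRK => /(_ (lexx _))[].
have ex2 a t : 0 < t -> ln (s ^+ 2) <= ln (t * s) -> ln s <= ln t.
  by move=> t0; rewrite lnXn // lnM ?posrE // mulr2n lerD2r.
split; first exact: above_symmetric_cone sx uz.
- apply/le_anti/andP; split; first exact/(thompson_le ux uz s0).
  have [t t0 [dE g g']] := tE x z ux uz; rewrite dE; apply: ex2 => //.
  by rewrite -dxy; apply: (tri x z y).
- apply/le_anti/andP; split; first exact/(thompson_le uz uy s0).
  have [t t0 [dE g g']] := tE y z uy uz; rewrite dC dE; apply: ex2 => //.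
  by rewrite -dxy dC; apply: (tri y z x).
Qed.
End Thompson.
(** * The canonical midpoint of x and e *)

(** A linear map of the plane that maps the quadrant onto itself permutes the
    two boundary rays: the preimages of the coordinate axes are, up to sign,
    (q, -p) and (s, -r), and the sign of the determinant decides which of these
    lie in the quadrant. *)
Lemma quadrant_monomial (F : realFieldType) (p q r s : F) :
  (forall a b, (0 <= a /\ 0 <= b) <-> (0 <= a * p + b * q /\ 0 <= a * r + b * s)) ->
  [/\ 0 < p, q = 0, r = 0 & 0 < s] \/ [/\ p = 0, 0 < q, 0 < r & s = 0].
Proof.
move=> H; have [_ D1] := H q (- p); have [_ D2] := H (- q) p.
have [_ D3] := H s (- r); have [_ D4] := H (- s) r.
have [/(_ (conj ler01 (lexx 0)))[p0 r0] _] := H 1 0.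
have [/(_ (conj (lexx 0) ler01))[q0 s0] _] := H 0 1.
have [_ N1] := H (-1) 0.
rewrite !mul1r !mul0r !addr0 !add0r in p0 q0 r0 s0.
have [D|D|D] := ltgtP (p * s) (q * r).
- right; have [_ p1] : 0 <= q /\ 0 <= - p by apply: D1; split; lra.
  have [s1 _] : 0 <= - s /\ 0 <= r by apply: D4; split; lra.
  have [pE sE] : p = 0 /\ s = 0 by split; lra.
  move: D; rewrite pE mul0r => D; split=> //.
    by rewrite lt_neqAle q0 andbT; apply/eqP => q1; rewrite -q1 mul0r ltxx in D.
  by rewrite lt_neqAle r0 andbT; apply/eqP => r1; rewrite -r1 mulr0 ltxx in D.
- left; have [q1 _] : 0 <= - q /\ 0 <= p by apply: D2; split; lra.
  have [_ r1] : 0 <= s /\ 0 <= - r by apply: D3; split; lra.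
  have [qE rE] : q = 0 /\ r = 0 by split; lra.
  move: D; rewrite qE mul0r => D; split=> //.
    by rewrite lt_neqAle p0 andbT; apply/eqP => q2; rewrite -q2 mul0r ltxx in D.
  by rewrite lt_neqAle s0 andbT; apply/eqP => r2; rewrite -r2 mulr0 ltxx in D.
- have [_ p1] : 0 <= q /\ 0 <= - p by apply: D1; split; lra.
  have [_ r1] : 0 <= s /\ 0 <= - r by apply: D3; split; lra.
  have [] : 0 <= -1 :> F /\ 0 <= 0 :> F by apply: N1; split; lra.
  by lra.
Qed.

Section Canonical.
Variables (R : realType) (V : vectType R) (A : euclidean_jordan_algebra V).
Implicit Types (x y z w u v d : V) (a b t : R).

Local Notation "x ** y" := (jmul A x y) (at level 40, left associativity).
Local Notation e := (junit A).
Local Notation "''[' x , y ]" := (inner A x y) : ring_scope.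
Local Notation K := (squares A).

Definition inner_functional (U : {vspace V}) d (z : subvs_of U) : R^o :=
  '[d, vsval z].

Lemma inner_functional_linear U d : linear (@inner_functional U d).
Proof.
move=> a u v; have E : vsval (a *: u + v) = a *: vsval u + vsval v.
  by rewrite linearP.
by rewrite /inner_functional E innerDr innerZr.
Qed.

HB.instance Definition _ U d := GRing.isLinear.Build R (subvs_of U) R^o _
  (@inner_functional U d) (@inner_functional_linear U d).

Variables (x : V) (k : nat) (lam : 'I_k -> R) (c : 'I_k -> V).
Hypothesis dec : spectral_decomposition A x lam c.
Hypothesis lam_gt0 : forall i, 0 < lam i.
Variables (imax imin : 'I_k).
Hypothesis lam_le : forall i, lam i <= lam imax.
Hypothesis lam_ge : forall i, lam imin <= lam i.

Let M := lam imax.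
Let m := lam imin.
Let U := <<[:: x; e]>>%VS.
Let X := vsproj U x.
Let E := vsproj U e.

Let xU : x \in U. Proof. by rewrite memv_span ?mem_head. Qed.
Let eU : e \in U. Proof. by rewrite memv_span ?inE ?eqxx ?orbT. Qed.
Let valX : vsval X = x. Proof. exact: vsprojK. Qed.
Let valE : vsval E = e. Proof. exact: vsprojK. Qed.

Let c0 i : c i != 0. Proof. by case: dec. Qed.
Let sys : complete_orthogonal_system A c. Proof. by case: dec. Qed.

Lemma mulJ_spectral i : c i ** x = lam i *: c i.
Proof. by case: dec => _ _ _ ->; rewrite sys_mulJ. Qed.

Lemma junit_neq0 : e != 0.
Proof.
apply/eqP => e0; have := c0 imax; rewrite -(mul1J A (c imax)) e0 mulJ0l.
by rewrite eqxx.
Qed.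

Lemma free_gap : free [:: x; e] -> 0 < M - m.
Proof.
move=> fr; rewrite subr_gt0 lt_neqAle lam_ge andbT; apply/eqP => mM.
have xE : x = M *: e.
  have := spectral_comb 1 0 dec; rewrite scale1r scale0r addr0 => ->.
  case: sys => _ _ <-; rewrite scaler_sumr; apply: eq_bigr => i _.
  congr (_ *: _); rewrite mul1r addr0; apply/le_anti.
  by rewrite lam_le andTb -mM; apply: lam_ge.
move: fr; rewrite free_cons span_seq1 => /andP[/negP[]] .
by apply/vlineP; exists M.
Qed.

(** Up to a factor, u1 and u2 are the extreme rays of the planar cone K(x, e):
    in a x + b e the nonnegativity of all a lam i + b is decided by the two
    extremal eigenvalues. *)
Let u1 := X - m *: E.
Let u2 := M *: E - X.
Hypothesis gap : 0 < M - m.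

Let valZ a (z : subvs_of U) : vsval (a *: z) = a *: vsval z.
Proof. exact: linearZ_LR. Qed.
Let valD (z w : subvs_of U) : vsval (z + w) = vsval z + vsval w.
Proof. exact: linearD. Qed.
Let valB (z w : subvs_of U) : vsval (z - w) = vsval z - vsval w.
Proof. exact: linearB. Qed.
Let val_u1 : vsval u1 = x - m *: e.
Proof. by rewrite /u1 valB valZ valX valE. Qed.
Let val_u2 : vsval u2 = M *: e - x.
Proof. by rewrite /u2 valB valZ valX valE. Qed.

Lemma gap_val a b : vsval (a *: u1 + b *: u2) =
  (a - b) *: x + (b * M - a * m) *: e.
Proof.
rewrite valD !valZ val_u1 val_u2; apply: (@innerP _ _ A) => w.
by rewrite !(innerDl, innerNl, innerZl); ring.
Qed.

Lemma gap_basis (z : subvs_of U) : exists a b, z = a *: u1 + b *: u2.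
Proof.
have : vsval z \in (<[x]> + <[e]>)%VS.
  by rewrite -[<[e]>%VS]span_seq1 -span_cons subvsP.
move=> /memv_addP[_ /vlineP[a ->] [_ /vlineP[b ->] h]].
exists ((a * M + b) / (M - m)), ((a * m + b) / (M - m)); apply: subvs_inj.
rewrite gap_val h.
apply: (@innerP _ _ A) => w; rewrite !(innerDl, innerNl, innerZl).
by field; rewrite gt_eqF.
Qed.

(** In the coordinates given by u1 and u2 the cone is the standard
    quadrant. *)
Lemma gap_coneP a b : K (vsval (a *: u1 + b *: u2)) <-> 0 <= a /\ 0 <= b.
Proof.
rewrite gap_val (spectral_combP _ _ dec); split=> [h|[a0 b0] i].
  have := h imax; have := h imin; rewrite -/M -/m => h1 h2.
  split; rewrite -(pmulr_lge0 _ gap); lra.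
have -> : (a - b) * lam i + (b * M - a * m) = a * (lam i - m) + b * (M - lam i).
  by ring.
by rewrite addr_ge0 ?mulr_ge0 ?subr_ge0.
Qed.

Lemma gap_E : E = (M - m)^-1 *: (1 *: u1 + 1 *: u2).
Proof.
apply: subvs_inj; rewrite valZ gap_val valE.
apply: (@innerP _ _ A) => w; rewrite !(innerDl, innerNl, innerZl).
by field; rewrite gt_eqF.
Qed.

Lemma gap_X : X = (M - m)^-1 *: (M *: u1 + m *: u2).
Proof.
apply: subvs_inj; rewrite valZ gap_val valX.
apply: (@innerP _ _ A) => w; rewrite !(innerDl, innerNl, innerZl).
by field; rewrite gt_eqF.
Qed.

Lemma sqrt_scaled t p q : 0 <= t -> 0 <= p -> 0 <= q ->
  Num.sqrt (q * (t * p) * (q * p)) = q * (Num.sqrt t * p).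
Proof.
move=> t0 p0 q0; have -> : q * (t * p) * (q * p) = t * (q * p) ^+ 2 by ring.
by rewrite sqrtrM // sqrtr_sqr ger0_norm ?mulr_ge0 // mulrCA.
Qed.

Let D := (M - m)^-1.
(** The point at which the two extremal eigenvalue functionals take the values
    sqrt M and sqrt m. *)
Let mu := (D * Num.sqrt M) *: u1 + (D * Num.sqrt m) *: u2.

Let hom_Z (psi : 'Hom(subvs_of U, R^o)) a (z : subvs_of U) :
  psi (a *: z) = a * psi z.
Proof. exact: linearZ_LR. Qed.

Let hom_comb (psi : 'Hom(subvs_of U, R^o)) a b (z w : subvs_of U) :
  psi (a *: z + b *: w) = a * psi z + b * psi w.
Proof. by rewrite -!hom_Z; exact: linearD. Qed.

Let hom_E (psi : 'Hom(subvs_of U, R^o)) : psi E = D * (psi u1 + psi u2).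
Proof. by rewrite gap_E hom_Z hom_comb !mul1r. Qed.

Let hom_X (psi : 'Hom(subvs_of U, R^o)) : psi X = D * (M * psi u1 + m * psi u2).
Proof. by rewrite gap_X hom_Z hom_comb. Qed.

(** The canonical midpoint does not depend on the functionals: by
    [quadrant_monomial] they are positive multiples of the coordinates along u1
    and u2, in one of the two orders, and the defining equations are homogeneous
    and symmetric. *)
Lemma canonical_mu_unique (psi1 psi2 : 'Hom(subvs_of U, R^o)) (nu : subvs_of U) :
  (forall z : subvs_of U, K (vsval z) <-> 0 <= psi1 z /\ 0 <= psi2 z) ->
  psi1 nu = Num.sqrt (psi1 X * psi1 E) ->
  psi2 nu = Num.sqrt (psi2 X * psi2 E) -> nu = mu.
Proof.
move=> H; have [a [b ->]] := gap_basis nu; rewrite !hom_E !hom_X !hom_comb.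
move=> h1 h2.
have M0 : 0 <= M by exact: ltW (lam_gt0 imax).
have m0 : 0 <= m by exact: ltW (lam_gt0 imin).
have D0 : 0 < D by rewrite invr_gt0.
have [] : [/\ 0 < psi1 u1, psi1 u2 = 0, psi2 u1 = 0 & 0 < psi2 u2] \/
    [/\ psi1 u1 = 0, 0 < psi1 u2, 0 < psi2 u1 & psi2 u2 = 0].
- by apply: quadrant_monomial => s t; rewrite -gap_coneP H !hom_comb.
- case=> p0 q0 r0 s0.
  rewrite q0 !mulr0 !addr0 sqrt_scaled ?(ltW p0) ?(ltW D0) // mulrA in h1.
  rewrite r0 !mulr0 !add0r sqrt_scaled ?(ltW s0) ?(ltW D0) // mulrA in h2.
  by rewrite (mulIf (lt0r_neq0 p0) h1) (mulIf (lt0r_neq0 s0) h2).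
- case=> p0 q0 r0 s0.
  rewrite p0 !mulr0 !add0r sqrt_scaled ?(ltW q0) ?(ltW D0) // mulrA in h1.
  rewrite s0 !mulr0 !addr0 sqrt_scaled ?(ltW r0) ?(ltW D0) // mulrA in h2.
  by rewrite (mulIf (lt0r_neq0 q0) h1) (mulIf (lt0r_neq0 r0) h2).
Qed.

Lemma mulJ_canonical_mu :
  c imax ** vsval mu = Num.sqrt M *: c imax /\
  c imin ** vsval mu = Num.sqrt m *: c imin.
Proof.
rewrite gap_val !mulJDr !mulJZr !mulJ1 !mulJ_spectral !scalerA -!scalerDl.
by split; congr (_ *: _); rewrite -/M -/m /D; field; rewrite gt_eqF.
Qed.

Let inner_x i : '[c i, x] = lam i * '[c i, c i].
Proof. by rewrite -{1}(sys_idem sys i) innerM mulJ_spectral innerZr. Qed.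
Let inner_e i : '[c i, e] = '[c i, c i].
Proof. by rewrite -{1}(sys_idem sys i) innerM mulJ1. Qed.

Lemma inner_functional_comb i a b :
  linfun (@inner_functional U (c i)) (a *: u1 + b *: u2) =
  (a * (lam i - m) + b * (M - lam i)) * '[c i, c i].
Proof.
rewrite lfunE /= /inner_functional gap_val innerDr !innerZr inner_x inner_e.
ring.
Qed.

Lemma inner_functional_vsproj i :
  linfun (@inner_functional U (c i)) X = lam i * '[c i, c i] /\
  linfun (@inner_functional U (c i)) E = '[c i, c i].
Proof. by rewrite !lfunE /= /inner_functional valX valE inner_x inner_e. Qed.

(** Pairing with the spectral idempotents of the extremal eigenvalues provides
    functionals of the required kind. *)
Lemma canonical_mu_exists :
  free [:: x; e] -> is_canonical_midpoint A x e (vsval mu).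
Proof.
move=> fr; rewrite /is_canonical_midpoint fr.
have nM := inner_gt0 A (c0 imax); have nm := inner_gt0 A (c0 imin).
pose psi i := linfun (@inner_functional U (c i)).
have psi1 a b : psi imax (a *: u1 + b *: u2) = a * ((M - m) * '[c imax, c imax]).
  by rewrite /psi inner_functional_comb -/M subrr mulr0 addr0 mulrA.
have psi2 a b : psi imin (a *: u1 + b *: u2) = b * ((M - m) * '[c imin, c imin]).
  by rewrite /psi inner_functional_comb -/m subrr mulr0 add0r mulrA.
exists (psi imax), (psi imin), mu; split=> //.
- rewrite free_cons seq1_free span_seq1; apply/andP; split.
    apply/vlineP => -[t psiE]; have := psi1 1 0; rewrite psiE scale_lfunE psi2.
    rewrite mul0r scaler0 mul1r => /esym/eqP.
    by rewrite mulf_eq0 !gt_eqF.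
  apply/eqP => psi0; have := psi2 0 1; rewrite psi0 lfunE /= mul1r => /esym/eqP.
  by rewrite mulf_eq0 !gt_eqF.
- move=> z; have [a [b ->]] := gap_basis z.
  by rewrite gap_coneP psi1 psi2 !pmulr_lge0 ?mulr_gt0.
- rewrite psi1 /psi; have [-> ->] := inner_functional_vsproj imax.
  have := sqrt_scaled (ltW (lam_gt0 imax)) (inner_ge0 A (c imax)) ler01.
  by rewrite !mul1r => ->; rewrite -/M /D; field; rewrite gt_eqF.
- rewrite psi2 /psi; have [-> ->] := inner_functional_vsproj imin.
  have := sqrt_scaled (ltW (lam_gt0 imin)) (inner_ge0 A (c imin)) ler01.
  by rewrite !mul1r => ->; rewrite -/m /D; field; rewrite gt_eqF.
Qed.
End Canonical.

Section CanonicalMul.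
Variables (R : realType) (V : vectType R) (A : euclidean_jordan_algebra V).
Variables (x : V) (k : nat) (lam : 'I_k -> R) (c : 'I_k -> V).
Hypothesis dec : spectral_decomposition A x lam c.
Hypothesis lam_gt0 : forall i, 0 < lam i.
Variables (imax imin : 'I_k).
Hypothesis lam_le : forall i, lam i <= lam imax.
Hypothesis lam_ge : forall i, lam imin <= lam i.
Local Notation e := (junit A).

(** The only property of the canonical midpoint that matters for the affine
    span: on the extremal spectral idempotents it agrees with the square root of
    x.  It covers the degenerate case, where x is a multiple of e, as well. *)
Lemma canonical_midpoint_mulJ i : lam i = lam imax \/ lam i = lam imin ->
  jmul A (c i) (canonical_midpoint A x e) = Num.sqrt (lam i) *: c i.
Proof.
move=> hi; have injl : injective lam by case: dec.
rewrite /canonical_midpoint; case fr: (free [:: x; e]).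
  have gap := free_gap dec lam_le lam_ge fr.
  have ex := canonical_mu_exists dec lam_gt0 lam_le lam_ge gap fr.
  have /= := @xgetPex _ 0 [set m | is_canonical_midpoint A x e m] (ex_intro _ _ ex).
  rewrite {1}/is_canonical_midpoint fr => -[psi1 [psi2 [nu [_ H h1 h2 ->]]]].
  rewrite (canonical_mu_unique dec lam_gt0 lam_le lam_ge gap H h1 h2).
  have [g1 g2] := mulJ_canonical_mu dec gap.
  by case: hi => /injl ->.
have sys : complete_orthogonal_system A c by case: dec.
have c0 j : c j != 0 by case: dec.
have x_e : exists t, x = t *: e.
  move/negbT: fr; rewrite free_cons seq1_free (junit_neq0 dec imax) andbT negbK.
  by rewrite span_seq1 => /vlineP.
have exP : exists m, is_canonical_midpoint A x e m.
  have [t xE] := x_e; have te : t *: c i = lam i *: c i.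
    by rewrite -(mulJ_spectral dec) xE mulJZr mulJ1.
  have tl : t = lam i.
    apply/eqP; rewrite -subr_eq0; move/eqP: te.
    by rewrite -subr_eq0 -scalerBl scaler_eq0 (negPf (c0 i)) orbF.
  exists (Num.sqrt t^-1 *: x); rewrite /is_canonical_midpoint fr.
  have t0 : 0 < t by rewrite tl.
  exists t^-1; rewrite ?invr_gt0 //; split=> //.
  by rewrite xE scalerA mulVf ?scale1r ?gt_eqF.
have /= := @xgetPex _ 0 [set m | is_canonical_midpoint A x e m] exP.
rewrite {1}/is_canonical_midpoint fr.
case=> l l0 [eE ->]; rewrite mulJZr (mulJ_spectral dec) scalerA.
have ll : l * lam i = 1.
  have : c i = (l * lam i) *: c i.
    by rewrite -scalerA -(mulJ_spectral dec) -mulJZr -eE mulJ1.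
  move/eqP; rewrite -subr_eq0 -{1}[c i]scale1r -scalerBl scaler_eq0.
  by rewrite (negPf (c0 i)) orbF subr_eq0 => /eqP.
congr (_ *: _); have -> : l = (lam i)^-1.
  by apply: (mulIf (lt0r_neq0 (lam_gt0 i))); rewrite ll mulVf ?gt_eqF.
have s0 : Num.sqrt (lam i) != 0 by rewrite gt_eqF ?sqrtr_gt0.
rewrite sqrtrV ?ltW // -{2}(sqr_sqrtr (ltW (lam_gt0 i))) expr2 mulKf //.
Qed.
End CanonicalMul.
(** * Order units of Peirce spaces *)

Lemma finite_lower_bound (F : realFieldType) (k : nat) (f : 'I_k -> F) :
  (forall i, 0 < f i) -> exists2 d, 0 < d & forall i, d <= f i.
Proof.
case: k f => [|k] f f0; first by exists 1 => // -[].
case: (@Order.TotalTheory.arg_minP _ _ _ ord0 xpredT f) => // i _ h.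
by exists (f i) => // j; apply: h.
Qed.

Section Peirce.
Variables (R : realType) (V : vectType R) (A : euclidean_jordan_algebra V).
Implicit Types (x y z w u v d : V) (a b t : R).

Local Notation "x ** y" := (jmul A x y) (at level 40, left associativity).
Local Notation e := (junit A).
Local Notation "''[' x , y ]" := (inner A x y) : ring_scope.
Local Notation K := (squares A).
Local Notation "x <=K y" := (cone_le A x y) (at level 70).

Lemma idempotent_remainder u v :
  u ** u = u -> v ** v = v -> u ** v = 0 -> K (e - u - v).
Proof.
move=> uu vv uv; apply: idempotent_cone.
rewrite !(mulJBr, mulJBl) !mul1J !mulJ1 uu vv (mulJC A v u) uv.
apply: (@innerP _ _ A) => w; rewrite !(innerBl, inner0l); ring.
Qed.

(** e - u is an order unit for the Peirce space V(u, 0).  The spectral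
    idempotents d_j of w with nonzero eigenvalue are annihilated by u, because
    <w^2, u> = <w, u w> = 0; so their sum lies below e - u. *)
Lemma peirce0_bound u w : u ** u = u -> u ** w = 0 ->
  exists2 b, 0 < b & K (b *: (e - u) - w) /\ K (b *: (e - u) + w).
Proof.
move=> uu uw; have [k [m [d [_ d0 sys wE]]]] := spectral_theorem A w.
have ud j : m j != 0 -> u ** d j = 0.
  move=> mj; have Kd i : K (d i) by apply: idempotent_cone (sys_idem sys i).
  have ge0 i : 0 <= '[d i, u] by rewrite inner_cone_ge0 //; apply: idempotent_cone.
  have : '[w ** w, u] = 0 by rewrite innerC -innerM mulJC uw inner0l.
  rewrite wE (sys_mulJ2 sys) inner_suml => /eqP.
  rewrite psumr_eq0 => [/allP/(_ j (mem_index_enum j))|i _]; last first.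
    by rewrite innerZl -expr2 mulr_ge0 ?sqr_ge0.
  rewrite innerZl !mulf_eq0 (negPf mj) /= => /eqP.
  exact: cone_idem_orth.
pose g j := (m j != 0)%:R : R.
pose s := \sum_j g j *: d j.
have us : u ** s = 0.
  rewrite mulJsumr big1 // => j _; rewrite mulJZr /g.
  by have [_|/ud ->] := eqVneq; rewrite ?scale0r ?scaler0.
have ss : s ** s = s.
  rewrite (sys_mulJ2 sys); apply: eq_bigr => j _.
  by rewrite /g; case: eqP; rewrite ?mulr0 ?mulr1.
pose b := 1 + \sum_j `|m j|.
have b0 : 0 < b by rewrite ltr_pwDl // sumr_ge0.
have mb j : `|m j| <= b.
  by rewrite /b (bigD1 j) //= addrCA lerDl addr_ge0 // sumr_ge0.
have Kr : K (b *: (e - u - s)).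
  by apply: coneZ (ltW b0) _; apply: idempotent_remainder.
have sE t : b *: (e - u) + t *: w =
    b *: (e - u - s) + \sum_j (b * g j + t * m j) *: d j.
  under eq_bigr do rewrite scalerDl -!scalerA.
  rewrite big_split -!scaler_sumr /= -/s -wE addrA; congr (_ + _).
  by rewrite -scalerDr subrK.
have Kt t : `|t| <= 1 -> K (b *: (e - u) + t *: w).
  move=> t1; rewrite sE; apply: coneD => //; apply: (sys_cone sys) => j.
  rewrite /g; have [->|_] := eqVneq; first by rewrite !mulr0 addr0.
  rewrite mulr1 -lerBlDl sub0r lerNl (le_trans (ler_norm _)) // normrN normrM.
  by rewrite (le_trans _ (mb j)) // ler_piMl.
exists b => //; split.
  by rewrite -[- w]scaleN1r; apply: Kt; rewrite normrN1.
by rewrite -[w in _ + w]scale1r; apply: Kt; rewrite normr1.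
Qed.

Section Subsystem.
Variables (k : nat) (c : 'I_k -> V) (C : pred 'I_k).
Hypothesis sys : complete_orthogonal_system A c.

Lemma subsystemE : \sum_(i | C i) c i = \sum_i (C i)%:R *: c i.
Proof.
rewrite big_mkcond; apply: eq_bigr => i _.
by case: (C i); rewrite ?scale1r ?scale0r.
Qed.

Lemma subsystem_idem :
  (\sum_(i | C i) c i) ** (\sum_(i | C i) c i) = \sum_(i | C i) c i.
Proof.
rewrite subsystemE (sys_mulJ2 sys); apply: eq_bigr => i _.
by case: (C i); rewrite ?mulr1 ?mulr0.
Qed.

(** If the coefficients outside C are at least d > 0, the element stays in the
    cone under small perturbations in the Peirce 0-space of the sum over C; the
    coefficients inside C may vanish. *)
Lemma subsystem_peirce0 w : (\sum_(i | C i) c i) ** w = 0 ->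
  exists2 b, 0 < b & forall (a : 'I_k -> R) (d t : R), `|t| * b <= d ->
    (forall i, 0 <= a i) -> (forall i, ~~ C i -> d <= a i) ->
    K (\sum_i a i *: c i + t *: w).
Proof.
set u := \sum_(i | C i) c i => uw.
have [b b0 [Kb1 Kb2]] := peirce0_bound subsystem_idem uw.
exists b => // a d t td a0 ad.
have uE : e - u = \sum_i (~~ C i)%:R *: c i.
  rewrite /u subsystemE (sys_junit sys) -sumrB; apply: eq_bigr => i _.
  by rewrite -scalerBl; case: (C i); rewrite ?subrr ?subr0.
have K1 : K (\sum_i (a i - d * (~~ C i)%:R) *: c i).
  apply: (sys_cone sys) => i; case Ci: (C i); first by rewrite mulr0 subr0.
  by rewrite mulr1 subr_ge0 ad ?Ci.
have K2 : K ((d - `|t| * b) *: (e - u)).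
  apply: coneZ; first by rewrite subr_ge0.
  by rewrite uE; apply: (sys_cone sys) => i; apply: ler0n.
have K3 : K ((`|t| * b) *: (e - u) + t *: w).
  have [t0|t0] := ger0P t.
    by rewrite -scalerA -scalerDr; apply: coneZ.
  have -> : (- t * b) *: (e - u) + t *: w = (- t) *: (b *: (e - u) - w).
    by rewrite [RHS]scalerBr [in RHS]scalerA [(- t) *: w]scaleNr opprK.
  apply: coneZ => //.
  by rewrite oppr_ge0 ltW.
have := coneD K1 (coneD K2 K3); rewrite [X in _ + X]addrA -scalerDl subrK addrA.
rewrite uE scaler_sumr -big_split /=.
by under eq_bigr do rewrite scalerA -scalerDl subrK.
Qed.
End Subsystem.
End Peirce.
(** * Rigidity and flexibility of midpoints *)
Section Main.
Variables (R : realType) (V : vectType R) (A : euclidean_jordan_algebra V).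
Variables (x : V) (k : nat) (lam : 'I_k -> R) (c : 'I_k -> V).
Hypothesis hx : symmetric_cone A x.
Hypothesis dec : spectral_decomposition A x lam c.
Hypothesis e_neq0 : junit A != 0.

Local Notation "x ** y" := (jmul A x y) (at level 40, left associativity).
Local Notation e := (junit A).
Local Notation "''[' x , y ]" := (inner A x y) : ring_scope.
Local Notation K := (squares A).
Local Notation "x <=K y" := (cone_le A x y) (at level 70).

Let sys : complete_orthogonal_system A c. Proof. by case: dec. Qed.
Let c_neq0 i : c i != 0. Proof. by case: dec. Qed.

Lemma eigenvalue_gt0 i : 0 < lam i.
Proof.
have [a a0 ax] := symmetric_cone_above hx.
have : K (1 *: x + (- a) *: e) by rewrite scale1r scaleNr.
by move/(spectral_combP _ _ dec)/(_ i); rewrite mul1r subr_ge0; apply: lt_le_trans.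
Qed.

Lemma eigenvalue_extrema : exists imax imin,
  (forall i, lam i <= lam imax) /\ (forall i, lam imin <= lam i).
Proof.
have [i0] : exists i0 : 'I_k, True.
  case: sys => _ _; case: k c => [|n] c' eE; last by exists ord0.
  by move: e_neq0; rewrite -eE big_ord0 eqxx.
move=> _.
case: (@Order.TotalTheory.arg_minP _ _ _ i0 xpredT lam) => // imin _ hmin.
case: (@Order.TotalTheory.arg_maxP _ _ _ i0 xpredT lam) => // imax _ hmax.
by exists imax, imin; split=> i; [apply: hmax | apply: hmin].
Qed.

Variables (imax imin : 'I_k).
Hypothesis lam_le : forall i, lam i <= lam imax.
Hypothesis lam_ge : forall i, lam imin <= lam i.

Let spectrum_lam i : spectrum A x (lam i).
Proof. by exists k, lam, c; split=> //; exists i. Qed.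

Lemma le_unitP t : x <=K t *: e <-> forall i, lam i <= t.
Proof.
rewrite /cone_le addrC -scaleN1r (spectral_combP _ _ dec).
by split=> h i; have := h i; rewrite mulN1r addrC subr_ge0.
Qed.

Lemma unit_leP t : e <=K t *: x <-> forall i, 1 <= t * lam i.
Proof.
rewrite /cone_le -scaleN1r (spectral_combP _ _ dec).
by split=> h i; have := h i; rewrite subr_ge0.
Qed.

(** The inequalities lam imin e <= x <= lam imax e, once proved, no longer
    mention a decomposition, and so bound the eigenvalues in every spectral
    decomposition of x. *)
Lemma spectrum_bounds t : spectrum A x t -> lam imin <= t <= lam imax.
Proof.
move=> [k' [lam' [c' [dec' [j ->]]]]]; apply/andP; split.
  have : K (1 *: x + (- lam imin) *: e).
    by apply/(spectral_combP _ _ dec) => i; rewrite mul1r subr_ge0.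
  by move/(spectral_combP _ _ dec')/(_ j); rewrite mul1r subr_ge0.
have : K (-1 *: x + lam imax *: e).
  by apply/(spectral_combP _ _ dec) => i; rewrite mulN1r addrC subr_ge0.
by move/(spectral_combP _ _ dec')/(_ j); rewrite mulN1r addrC subr_ge0.
Qed.

Lemma lambda_maxE : lambda_max A x = lam imax.
Proof.
apply/le_anti/andP; split.
  by apply: ge_sup; [exists (lam imax) | move=> t /spectrum_bounds/andP[]].
by apply: ub_le_sup => //; exists (lam imax) => t /spectrum_bounds/andP[].
Qed.

Lemma lambda_minE : lambda_min A x = lam imin.
Proof.
apply/le_anti/andP; split.
  by apply: ge_inf => //; exists (lam imin) => t /spectrum_bounds/andP[].
by apply: lb_le_inf; [exists (lam imin) | move=> t /spectrum_bounds/andP[]].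
Qed.

Let r := Num.max (lam imax) (lam imin)^-1.
Let s := Num.sqrt r.
Let q i := Num.sqrt (lam i).

Let lam_r i : lam i <= r.
Proof. by rewrite (le_trans (lam_le i)) // le_max lexx. Qed.
Let lamV_r i : (lam i)^-1 <= r.
Proof.
rewrite (@le_trans _ _ (lam imin)^-1) ?le_max ?lexx ?orbT //.
by rewrite lef_pV2 ?posrE ?eigenvalue_gt0.
Qed.
Let r_gt0 : 0 < r. Proof. exact: lt_le_trans (eigenvalue_gt0 imax) (lam_r imax). Qed.
Let s_gt0 : 0 < s. Proof. by rewrite sqrtr_gt0. Qed.
Let s2 : s ^+ 2 = r. Proof. by rewrite sqr_sqrtr // ltW. Qed.
Let q_gt0 i : 0 < q i. Proof. by rewrite sqrtr_gt0 eigenvalue_gt0. Qed.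
Let q2 i : q i ^+ 2 = lam i. Proof. by rewrite sqr_sqrtr // ltW // eigenvalue_gt0. Qed.

Lemma thompson_unit : thompson A x e = ln (s ^+ 2).
Proof.
have ux := symmetric_cone_above hx.
have ue : above_unit A e by exists 1; rewrite // /cone_le scale1r subrr;
  exists 0; rewrite ?mulJ0r.
rewrite s2; apply/le_anti/andP; split.
  apply/(thompson_le e_neq0 ux ue r_gt0); split; first exact/le_unitP.
  by apply/unit_leP => i; rewrite -ler_pdivrMr ?eigenvalue_gt0 // mul1r.
have [+ _] := thompson_le e_neq0 ux ue (expR_gt0 (thompson A x e)).
rewrite expRK => /(_ (lexx _))[/le_unitP h1 /unit_leP h2].
rewrite -ler_expR lnK ?posrE ?r_gt0 // /r ge_max h1 /=.
by rewrite -[_^-1]mul1r ler_pdivrMr ?eigenvalue_gt0.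
Qed.

Let C i := Num.max (lam i) (lam i)^-1 == r.

Let extremalP i : C i -> [/\ lam i = lam imax & q i = s] \/
  [/\ lam i = lam imin & q i * s = 1].
Proof.
move/eqP; rewrite /Num.max; case: ifP => _ ri; [right | left].
  have l1 : lam i * r = 1 by rewrite -ri mulfV ?gt_eqF ?eigenvalue_gt0.
  split; last by rewrite -sqrtrM ?l1 ?sqrtr1 // ltW // eigenvalue_gt0.
  apply/le_anti; rewrite lam_ge andbT -lef_pV2 ?posrE ?eigenvalue_gt0 // ri.
  exact: lamV_r.
split; last by rewrite /q ri.
by apply/le_anti; rewrite lam_le ri lam_r.
Qed.

Let not_extremal i : ~~ C i -> lam i < r /\ 1 < lam i * r.
Proof.
move=> nC; have : Num.max (lam i) (lam i)^-1 < r.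
  by rewrite lt_neqAle nC ge_max lam_r lamV_r.
rewrite gt_max => /andP[h1 h2]; split=> //.
by rewrite mulrC -ltr_pdivrMr ?eigenvalue_gt0 // mul1r.
Qed.

Let ue : above_unit A e.
Proof.
exists 1; rewrite // /cone_le scale1r subrr; exists 0; rewrite ?mulJ0r //.
Qed.

Let midP := midpointsP e_neq0 hx ue s_gt0 thompson_unit.

(** Rigidity.  If lam i = s^2, the inequalities z <= s e and x <= s z leave only
    <z, c i> = s <e, c i>, so s e - z is an element of the cone orthogonal to
    c i, and [cone_idem_orth] applies; the case lam i = s^-2 is dual. *)
Lemma midpoint_mulJ z i : midpoints A x e z -> C i -> c i ** z = q i *: c i.
Proof.
move=> /midP[_ [h1 h2 h3 h4]] Ci.
have Kc := idempotent_cone (sys_idem sys i).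
have xc : '[x, c i] = lam i * '[c i, c i].
  by rewrite -{1}(sys_idem sys i) -innerM (mulJ_spectral dec) innerZl.
have ec : '[e, c i] = '[c i, c i].
  by rewrite -{1}(sys_idem sys i) -innerM mulJ1.
have := inner_cone_ge0 h1 Kc; have := inner_cone_ge0 h2 Kc.
have := inner_cone_ge0 h3 Kc; have := inner_cone_ge0 h4 Kc.
rewrite !(innerBl, innerZl) xc ec -(q2 i) => g4 g3 g2 g1.
have n0 := inner_gt0 A (c_neq0 i).
case: (extremalP Ci) => -[_ qs].
  have o : '[s *: e - z, c i] = 0.
    apply/le_anti; rewrite (inner_cone_ge0 h3 Kc) andbT.
    rewrite innerBl innerZl ec -(pmulr_rle0 _ s_gt0).
    by rewrite qs in g1; nra.
  have := cone_idem_orth (sys_idem sys i) h3 o.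
  by rewrite mulJBr mulJZr mulJ1 qs => /subr0_eq.
have o : '[s *: z - e, c i] = 0.
  apply/le_anti; rewrite (inner_cone_ge0 h4 Kc) andbT.
  rewrite innerBl innerZl ec.
  have : s * (s * (q i ^+ 2 * '[c i, c i]) - '[z, c i]) =
     (q i * s) ^+ 2 * '[c i, c i] - s * '[z, c i] by ring.
  rewrite qs expr1n mul1r => E.
  have : 0 <= s * (s * (q i ^+ 2 * '[c i, c i]) - '[z, c i]) by rewrite mulr_ge0 // ltW.
  by rewrite E -opprB oppr_ge0.
have := cone_idem_orth (sys_idem sys i) h4 o.
rewrite mulJBr mulJZr mulJ1 => /subr0_eq h.
by rewrite -[in RHS]h scalerA qs scale1r.
Qed.

Lemma canonical_mulJ i : C i -> c i ** canonical_midpoint A x e = q i *: c i.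
Proof.
move=> Ci; apply: (canonical_midpoint_mulJ dec eigenvalue_gt0 lam_le lam_ge).
by case: (extremalP Ci) => -[]; [left | right].
Qed.

Let u := \sum_(i | C i) c i.
Let z0 := \sum_i q i *: c i.

(** Flexibility.  z0 is the square root of x.  Each of the four inequalities of
    [midpointsP] at z0 + t w asks that a combination of the c i, perturbed by a
    multiple of w, lie in the cone; the coefficients at t = 0 are nonnegative,
    and positive for i outside C since there s^-2 < lam i < s^2. *)
Lemma midpoints_near_root w : u ** w = 0 -> exists2 d, 0 < d &
  forall t, 0 <= t <= d -> midpoints A x e (z0 + t *: w).
Proof.
move=> uw; have [b b0 Kb] := subsystem_peirce0 sys uw.
(* The two non-strict inequalities s^-1 <= q i <= s behind the nonnegativity of
   all four coefficients. *)
have q_s i : q i <= s by apply: ler_wsqrtr; apply: lam_r.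
have q_s1 i : 1 <= q i * s.
  rewrite -sqrtrM ?(ltW (eigenvalue_gt0 i)) // -[X in X <= _]sqrtr1.
  by apply: ler_wsqrtr; rewrite mulrC -ler_pdivrMr ?eigenvalue_gt0 // mul1r.
pose f i := if C i then 1 else
  Num.min (Num.min (s - q i) (s * q i - 1))
          (Num.min (s * q i - lam i) (s * lam i - q i)).
have f0 i : 0 < f i.
  rewrite /f; case: ifPn => // /not_extremal[h1 h2].
  have g1 : q i < s by rewrite ltr_sqrt.
  have g2 : 1 < s * q i.
    rewrite mulrC -sqrtrM ?(ltW (eigenvalue_gt0 i)) // -[X in X < _]sqrtr1.
    by rewrite ltr_sqrt // (lt_trans ltr01).
  rewrite !lt_min !subr_gt0 g1 g2 -(q2 i) expr2 ltr_pM2r // g1 /=.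
  by rewrite mulrA ltr_pMl.
have [d d0 df] := finite_lower_bound f0.
have dC i : ~~ C i -> [/\ d <= s - q i, d <= s * q i - 1, d <= s * q i - lam i
    & d <= s * lam i - q i].
  move=> nC; have := df i; rewrite /f (negPf nC) !le_min.
  by case/andP=> /andP[-> ->] /andP[-> ->].
(* The factor 1 + s makes both |t| b and |s t| b at most d: the four
   inequalities perturb by t w or by s t w. *)
exists (d / b / (1 + s)); first by rewrite !divr_gt0 // addr_gt0.
move=> t /andP[t0 td].
have td1 : t * (1 + s) * b <= d by rewrite -ler_pdivlMr // -ler_pdivlMr ?addr_gt0.
have tb : `|t| * b <= d.
  rewrite ger0_norm //; apply: le_trans td1; rewrite ler_pM2r //.
  by rewrite ler_peMr // lerDl ltW.
have tbN : `| - t| * b <= d by rewrite normrN.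
have tsb : `|s * t| * b <= d.
  rewrite ger0_norm ?mulr_ge0 ?(ltW s_gt0) //; apply: le_trans td1.
  by rewrite ler_pM2r // mulrC ler_wpM2l // lerDr.
have zE a a' g : a *: (z0 + t *: w) + (a' *: x + g *: e) =
    \sum_i (a * q i + (a' * lam i + g)) *: c i + (a * t) *: w.
  rewrite (spectral_comb _ _ dec) scalerDr scalerA addrAC /z0 scaler_sumr.
  rewrite -big_split; congr (_ + _); apply: eq_bigr => i _ /=.
  by rewrite scalerA -scalerDl.
have Kz a a' g : `|a * t| * b <= d ->
    (forall i, 0 <= a * q i + (a' * lam i + g)) ->
    (forall i, ~~ C i -> d <= a * q i + (a' * lam i + g)) ->
    K (a *: (z0 + t *: w) + (a' *: x + g *: e)).
  by move=> h1 h2 h3; rewrite zE; apply: Kb h1 h2 h3.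
have lamE i : lam i = q i * q i by rewrite -expr2 q2.
have h4 : e <=K s *: (z0 + t *: w).
  have := Kz s 0 (-1) tsb; rewrite scale0r add0r scaleN1r; apply=> i.
    by rewrite mul0r add0r mulrC subr_ge0.
  by case/dC => _; rewrite mul0r add0r.
apply/midP; split.
  exists s^-1; rewrite ?invr_gt0 //.
  have s1 : 0 <= s^-1 by rewrite invr_ge0 ltW.
  by have := cone_leZ s1 h4; rewrite scalerA mulVf ?scale1r ?gt_eqF.
split=> //.
- have := Kz s (-1) 0 tsb; rewrite scale0r addr0 scaleN1r; apply=> i.
    rewrite addr0 mulN1r subr_ge0 lamE ler_pM2r //.
  by case/dC => _ _; rewrite addr0 mulN1r.
- have := Kz (-1) s 0; rewrite scale0r addr0 scaleN1r addrC mulN1r; apply=> // i.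
    rewrite addr0 mulN1r addrC subr_ge0 lamE mulrA ler_peMl ?(ltW (q_gt0 i)) //.
    by rewrite mulrC.
  by case/dC => _ _ _; rewrite addr0 mulN1r addrC.
- have := Kz (-1) 0 s; rewrite scale0r add0r scaleN1r addrC mulN1r; apply=> // i.
    by rewrite mul0r add0r mulN1r addrC subr_ge0.
  by case/dC => + _ _ _; rewrite mul0r add0r mulN1r addrC.
Qed.

(** All midpoints, the canonical one and z0 have the same product with u, which
    gives one inclusion.  For the other, every point of z0 + V(u, 0) lies on a
    line through z0 and a nearby midpoint. *)
Lemma affine_span_midpoints : affine_span (midpoints A x e) =
  [set canonical_midpoint A x e + z | z in peirce A u 0].
Proof.
have uJ z : (forall i, C i -> c i ** z = q i *: c i) ->
    u ** z = \sum_(i | C i) q i *: c i.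
  by move=> h; rewrite mulJsuml; apply: eq_bigr => i /h.
have um := uJ _ canonical_mulJ.
apply/seteqP; split=> [_ [n [t [z [mz t1 ->]]]]|_ [y py <-]].
  exists (\sum_(i < n) t i *: z i - canonical_midpoint A x e); last first.
    by rewrite addrC subrK.
  rewrite /peirce /= scale0r mulJBr um mulJsumr.
  rewrite (eq_bigr (fun i => t i *: \sum_(j | C j) q j *: c j)) => [|i _].
    by rewrite -scaler_suml t1 scale1r subrr.
  by rewrite mulJZr uJ // => j; apply: midpoint_mulJ.
pose w := canonical_midpoint A x e + y - z0.
have uw : u ** w = 0.
  rewrite mulJBr mulJDr um (uJ z0) => [|i _]; last by rewrite (sys_mulJ sys).
  by move: py; rewrite /peirce /= scale0r => ->; rewrite addr0 subrr.
have [d d0 md] := midpoints_near_root uw.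
(* v = z0 + w = (1 - 1/d) z0 + (1/d) (z0 + d w). *)
exists 2, (fun i : 'I_2 => if i == ord0 then 1 - d^-1 else d^-1),
  (fun i : 'I_2 => if i == ord0 then z0 else z0 + d *: w); split.
- move=> i; case: eqP => _; last by apply: md; rewrite ltW //=.
  by rewrite -[z0]addr0 -(scale0r w); apply: md; rewrite lexx ltW.
- by rewrite big_ord_recl big_ord1 /= subrK.
- rewrite big_ord_recl big_ord1 /= scalerDr scalerA mulVf ?gt_eqF // scale1r.
  by rewrite addrA -scalerDl subrK scale1r /w addrC subrK.
Qed.
End Main.

Theorem theorem4p3 (R : realType) (V : vectType R)
    (A : euclidean_jordan_algebra V) (x : V)
    (hx : symmetric_cone A x) (hxe : x <> junit A)
    (k : nat) (lam : 'I_k -> R) (c : 'I_k -> V)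
    (hdec : spectral_decomposition A x lam c) :
  affine_span (midpoints A x (junit A)) =
  [set canonical_midpoint A x (junit A) + z
    | z in peirce A
        (\sum_(i < k | Num.max (lam i) (lam i)^-1
                       == Num.max (lambda_max A x) (lambda_min A x)^-1) c i)
        0].
Proof.
have e_neq0 : junit A != 0.
  apply/eqP => e0; apply: hxe.
  by rewrite e0 -[LHS](mul1J A) e0 mulJ0l.
have [imax [imin [lam_le lam_ge]]] := eigenvalue_extrema hdec e_neq0.
rewrite (lambda_maxE hdec lam_le lam_ge) (lambda_minE hdec lam_le lam_ge).
exact: affine_span_midpoints.
Qed.
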